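(* Let $k=\bigcup_{e\ge 1}\mathbb F_2(u^{1/2^e})$ be the perfect closure of the rational function field $\mathbb F_2(u)$. Let $$A=k[x,y]/(x^4+x^2y^2+uxy^3+y^4),\qquad \deg x=\deg y=1,$$ and $$\hat A=k[[x,y]]/(x^4+x^2y^2+uxy^3+y^4).$$ Then $A$ is a one-dimensional graded domain which does not have finite graded F-representation type, and $\hat A$ is a one-dimensional complete local domain which does not have finite F-representation type.
   Context: Let $R$ be a Noetherian commutative ring of prime characteristic $p$ (here $p=2$). For an $R$-module $M$ and $e\in\mathbb N=\{0,1,2,\dots\}$, ${}^eM$ denotes the $R$-module which equals $M$ as an abelian group, with $R$-action $r\cdot m:=r^{p^e}m$. $R$ has finite F-representation type if there are finitely many finitely generated $R$-modules $M_1,\dots,M_s$ such that for every $e\in\mathbb N$ there are nonnegative integers $n_{e,1},\dots,n_{e,s}$ with ${}^eR\cong\bigoplus_{i=1}^s M_i^{\oplus n_{e,i}}$ as $R$-modules. If $R$ is $\mathbb N$-graded and $M$ is a $\mathbb Z$-graded $R$-module, ${}^eM$ is a $\mathbb Q$-graded $R$-module via $[{}^eM]_\alpha=M_{p^e\alpha}$ if $\alpha\in\frac1{p^e}\mathbb Z$ and $[{}^eM]_\alpha=0$ otherwise. For a $\mathbb Q$-graded module $N$ and $a\in\mathbb Q$, $N(a)$ is the shifted module with $[N(a)]_b=N_{a+b}$. The graded ring $R$ has finite graded F-representation type if there are finitely many finitely generated $\mathbb Q$-graded $R$-modules $M_1,\dots,M_s$ such that for every $e\in\mathbb N$ there are nonnegative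 integers $n_{ei}$ and rational numbers $a^{(e)}_{ij}$ ($1\le i\le s$, $1\le j\le n_{ei}$) with a degree-preserving isomorphism of $\mathbb Q$-graded $R$-modules ${}^eR\cong\bigoplus_{i=1}^s\bigoplus_{j=1}^{n_{ei}}M_i(a^{(e)}_{ij})$. *)

(* Defs.v *)
From HB Require Import structures.
From mathcomp Require Import all_boot all_order all_algebra.
From mathcomp Require Import boolp.
From mathcomp Require Import zify.
From mathcomp.multinomials Require Import mpoly.

Set Implicit Arguments.
Unset Strict Implicit.
Unset Printing Implicit Defensive.

Import Order.TTheory GRing.Theory Num.Theory.
Local Open Scope ring_scope.
Local Open Scope quotient_scope.

Section PowChar.
Variables (R : comNzRingType) (p : nat) (charRp : p \in [pchar R]).

Lemma pchar_pnat e : [pchar R].-nat (p ^ e)%N.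
Proof.
have p_pr := pcharf_prime charRp.
by rewrite (eq_pnat _ (pcharf_eq charRp)) pnatX pnat_id.
Qed.

Lemma powD e (x y : R) : (x + y) ^+ (p ^ e) = x ^+ (p ^ e) + y ^+ (p ^ e).
Proof. exact/exprDn_pchar/pchar_pnat. Qed.

Lemma powN e (x : R) : (- x) ^+ (p ^ e) = - x ^+ (p ^ e).
Proof. exact/exprNn_pchar/pchar_pnat. Qed.

Lemma pow_gt0 e : (0 < p ^ e)%N.
Proof. by rewrite expn_gt0 prime_gt0 ?(pcharf_prime charRp). Qed.

Lemma pow0 e : (0 : R) ^+ (p ^ e) = 0.
Proof. by rewrite expr0n eqn0Ngt pow_gt0. Qed.

End PowChar.

Section PerfectClosure.
Variables (F : fieldType) (p : nat) (charFp : p \in [pchar F]).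

Lemma pow_inj e : injective (fun x : F => x ^+ (p ^ e)).
Proof.
move=> x y /= /eqP; rewrite -subr_eq0 -(powN charFp) -(powD charFp).
by rewrite expf_eq0 (pow_gt0 charFp) subr_eq0 => /eqP.
Qed.

(* The colimit of F -> F -> F -> ... along the Frobenius map: the pair (e, a)
   represents a^(1/p^e), so (e, a) and (f, b) are identified when
   a^(p^f) = b^(p^e). *)
Definition perf_rel (_ : p \in [pchar F]) (x y : nat * F) :=
  x.2 ^+ (p ^ y.1) == y.2 ^+ (p ^ x.1).

Lemma perf_rel_refl : reflexive (perf_rel charFp).
Proof. by move=> x; rewrite /perf_rel. Qed.

Lemma perf_rel_sym : ssrbool.symmetric (perf_rel charFp).
Proof. by move=> x y; rewrite /perf_rel eq_sym. Qed.

Lemma perf_rel_trans : transitive (perf_rel charFp).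
Proof.
move=> [f b] [e a] [g c]; rewrite /perf_rel /= => /eqP ab /eqP bc.
apply/eqP/(@pow_inj f); rewrite /= -!exprM mulnC exprM ab.
by rewrite -!exprM mulnC exprM bc -!exprM mulnC.
Qed.

Canonical perf_equiv :=
  EquivRel (perf_rel charFp) perf_rel_refl perf_rel_sym perf_rel_trans.

Definition perf := {eq_quot (perf_rel charFp)}.
HB.instance Definition _ : EqQuotient _ (perf_rel charFp) perf :=
  EqQuotient.on perf.
HB.instance Definition _ := Choice.on perf.

Lemma perf_eqP (x y : nat * F) :
  reflect (x.2 ^+ (p ^ y.1) = y.2 ^+ (p ^ x.1)) (x == y %[mod perf]).
Proof. by rewrite eqmodE; apply: eqP. Qed.

Lemma perf_reprP (x : nat * F) :
  (repr (\pi_perf x)).2 ^+ (p ^ x.1) = x.2 ^+ (p ^ (repr (\pi_perf x)).1).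
Proof. by apply/(perf_eqP (repr (\pi_perf x)) x); rewrite reprK. Qed.

Definition perf_emb := lift_embed perf (fun a : F => (0%N, a)).
Canonical perf_emb_pi_morph := PiEmbed perf_emb.

Definition perf_addf (x y : nat * F) : nat * F :=
  ((x.1 + y.1)%N, x.2 ^+ (p ^ y.1) + y.2 ^+ (p ^ x.1)).
Definition perf_add := lift_op2 perf perf_addf.

Lemma pow_cross (x y : F) a b c d e f : x ^+ (p ^ a) = y ^+ (p ^ b) ->
  (a <= e + f)%N -> (c + d + a = e + f + b)%N ->
  y ^+ (p ^ c) ^+ (p ^ d) = x ^+ (p ^ e) ^+ (p ^ f).
Proof.
move=> xy le_a eq_cd; rewrite -!exprM -!expnD.
have -> : (c + d = b + (e + f - a))%N by lia.
by rewrite -{2}(subnKC le_a) !expnD !exprM xy.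
Qed.

Lemma perf_pi_add : {morph \pi_perf : x y / perf_addf x y >-> perf_add x y}.
Proof.
move=> x y; unlock perf_add; apply/eqP/perf_eqP.
have := perf_reprP x; have := perf_reprP y.
case: (repr (\pi_perf x)) => e a; case: (repr (\pi_perf y)) => f b.
case: x y => [e' a'] [f' b'] /= Hb Ha.
by rewrite !(powD charFp); congr (_ + _); [apply: (pow_cross Ha) | apply: (pow_cross Hb)]; lia.
Qed.
Canonical perf_pi_add_morph := PiMorph2 perf_pi_add.

Definition perf_oppf (x : nat * F) : nat * F := (x.1, - x.2).
Definition perf_opp := lift_op1 perf perf_oppf.
Lemma perf_pi_opp : {morph \pi_perf : x / perf_oppf x >-> perf_opp x}.
Proof.
move=> x; unlock perf_opp; apply/eqP/perf_eqP.
by rewrite /= !(powN charFp) perf_reprP.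
Qed.
Canonical perf_pi_opp_morph := PiMorph1 perf_pi_opp.

Definition perf_mulf (x y : nat * F) : nat * F :=
  ((x.1 + y.1)%N, x.2 ^+ (p ^ y.1) * y.2 ^+ (p ^ x.1)).
Definition perf_mul := lift_op2 perf perf_mulf.
Lemma perf_pi_mul : {morph \pi_perf : x y / perf_mulf x y >-> perf_mul x y}.
Proof.
move=> x y; unlock perf_mul; apply/eqP/perf_eqP.
have := perf_reprP x; have := perf_reprP y.
case: (repr (\pi_perf x)) => e a; case: (repr (\pi_perf y)) => f b.
case: x y => [e' a'] [f' b'] /= Hb Ha.
by rewrite !exprMn; congr (_ * _); [apply: (pow_cross Ha) | apply: (pow_cross Hb)]; lia.
Qed.
Canonical perf_pi_mul_morph := PiMorph2 perf_pi_mul.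

Definition perf_invf (x : nat * F) : nat * F := (x.1, x.2^-1).
Definition perf_inv := lift_op1 perf perf_invf.
Lemma perf_pi_inv : {morph \pi_perf : x / perf_invf x >-> perf_inv x}.
Proof.
move=> x; unlock perf_inv; apply/eqP/perf_eqP.
by rewrite /= !exprVn perf_reprP.
Qed.
Canonical perf_pi_inv_morph := PiMorph1 perf_pi_inv.

Lemma perf_addA : associative perf_add.
Proof.
elim/quotW=> x; elim/quotW=> y; elim/quotW=> z; rewrite !piE.
apply/eqP/perf_eqP => /=; rewrite !(powD charFp) addrA -!exprM -!expnD.
by congr (_ ^+ (p ^ _) + _ ^+ (p ^ _) + _ ^+ (p ^ _)); lia.
Qed.

Lemma perf_addC : commutative perf_add.
Proof.
elim/quotW=> x; elim/quotW=> y; rewrite !piE; apply/eqP/perf_eqP => /=.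
by rewrite addrC addnC.
Qed.

Lemma perf_add0 : left_id (perf_emb 0) perf_add.
Proof.
elim/quotW=> x; rewrite !piE; apply/eqP/perf_eqP => /=.
by rewrite (pow0 charFp) add0r add0n expn0 expr1.
Qed.

Lemma perf_addN : left_inverse (perf_emb 0) perf_opp perf_add.
Proof.
elim/quotW=> x; rewrite !piE; apply/eqP/perf_eqP => /=.
by rewrite (pow0 charFp) (powN charFp) addNr expn0 expr1.
Qed.

HB.instance Definition _ :=
  GRing.isZmodule.Build perf perf_addA perf_addC perf_add0 perf_addN.

Lemma perf_mulA : associative perf_mul.
Proof.
elim/quotW=> x; elim/quotW=> y; elim/quotW=> z; rewrite !piE.
apply/eqP/perf_eqP => /=; rewrite !exprMn mulrA -!exprM -!expnD.
by congr (_ ^+ (p ^ _) * _ ^+ (p ^ _) * _ ^+ (p ^ _)); lia.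
Qed.

Lemma perf_mulC : commutative perf_mul.
Proof.
elim/quotW=> x; elim/quotW=> y; rewrite !piE; apply/eqP/perf_eqP => /=.
by rewrite mulrC addnC.
Qed.

Lemma perf_mul1 : left_id (perf_emb 1) perf_mul.
Proof.
elim/quotW=> x; rewrite !piE; apply/eqP/perf_eqP => /=.
by rewrite expr1n mul1r add0n expn0 expr1.
Qed.

Lemma perf_mulDl : left_distributive perf_mul perf_add.
Proof.
elim/quotW=> x; elim/quotW=> y; elim/quotW=> z; rewrite !piE.
apply/eqP/perf_eqP => /=.
rewrite !(powD charFp, exprMn, mulrDl) -!exprM -!expnD.
by congr (_ ^+ (p ^ _) * _ ^+ (p ^ _) + _ ^+ (p ^ _) * _ ^+ (p ^ _)); lia.
Qed.

Lemma perf_1neq0 : perf_emb 1 != perf_emb 0.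
Proof.
rewrite !piE /perf_rel /=.
by rewrite expn0 !expr1 oner_eq0.
Qed.

HB.instance Definition _ :=
  GRing.Zmodule_isComNzRing.Build perf
    perf_mulA perf_mulC perf_mul1 perf_mulDl perf_1neq0.

Lemma perf_mulV a : a != perf_emb 0 -> perf_mul (perf_inv a) a = perf_emb 1.
Proof.
elim/quotW: a => x; rewrite !piE /perf_rel /= (pow0 charFp) expn0 expr1 => x_neq0.
apply/eqP/perf_eqP => /=.
by rewrite expn0 expr1 expr1n -exprMn mulVf ?expr1n.
Qed.

Lemma perf_inv0 : perf_inv (perf_emb 0) = perf_emb 0.
Proof. by rewrite !piE; apply/eqP/perf_eqP; rewrite /= invr0. Qed.

HB.instance Definition _ := GRing.ComNzRing_isField.Build perf perf_mulV perf_inv0.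

(* a |-> a^(1/p^e), which extends the embedding perf_emb = perf_root 0 of F *)
Definition perf_root (e : nat) (a : F) : perf := \pi_perf (e, a).

Lemma perf_root0 : perf_root 0 =1 perf_emb.
Proof. by move=> a; rewrite /perf_root !piE. Qed.

Lemma perf_root_is_zmod_morphism e : zmod_morphism (perf_root e).
Proof.
move=> a b; rewrite -[perf_root e a - _]/(perf_add _ (perf_opp _)) !piE.
by apply/eqP/perf_eqP; rewrite /= -(powD charFp) -exprM -expnD.
Qed.
HB.instance Definition _ e :=
  GRing.isZmodMorphism.Build F perf (perf_root e) (perf_root_is_zmod_morphism e).

Lemma perf_root_is_monoid_morphism e : monoid_morphism (perf_root e).
Proof.
split=> [|a b].
  rewrite -[RHS]/(perf_emb 1) !piE; apply/eqP/perf_eqP => /=.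
  by rewrite !expr1n.
rewrite -[perf_root e a * _]/(perf_mul _ _) !piE.
by apply/eqP/perf_eqP; rewrite /= -exprMn -exprM -expnD.
Qed.
HB.instance Definition _ e :=
  GRing.isMonoidMorphism.Build F perf (perf_root e)
    (perf_root_is_monoid_morphism e).

Lemma perf_rootK e a : perf_root e a ^+ (p ^ e) = perf_root 0 a.
Proof.
rewrite -rmorphXn /perf_root; apply/eqP/perf_eqP => /=.
by rewrite expn0 expr1.
Qed.

Lemma perf_rootP (z : perf) : exists e a, z = perf_root e a.
Proof. by elim/quotW: z => -[e a]; exists e, a. Qed.

Lemma perf_pchar : p \in [pchar perf].
Proof. exact: (rmorph_pchar (perf_root 0)) charFp. Qed.

End PerfectClosure.

Notation "x %:F" := (@FracField.tofrac _ x) : ring_scope.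

Notation F2u := {fraction {poly 'F_2}}.

Lemma F2u_pchar : 2%N \in [pchar F2u].
Proof.
apply: (rmorph_pchar (@FracField.tofrac {poly 'F_2})).
apply: (rmorph_pchar (@polyC 'F_2)).
exact: pchar_Fp.
Qed.

Definition kperf : fieldType := perf F2u_pchar.
Definition uroot (e : nat) : kperf := perf_root F2u_pchar e ('X : {poly 'F_2})%:F.
Definition uperf : kperf := uroot 0.

Lemma kperf_pchar : 2%N \in [pchar kperf].
Proof. exact: perf_pchar. Qed.

Lemma urootK e : uroot e ^+ (2 ^ e) = uperf.
Proof. exact: perf_rootK. Qed.

(* kperf is the union of its subfields F_2(u^(1/2^e)) *)
Lemma kperf_union (z : kperf) : exists (e : nat) (P Q : {poly 'F_2}),
  let ev (S : {poly 'F_2}) := \sum_(i < size S) (nat_of_ord S`_i)%:R * uroot e ^+ i in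
  ev Q != 0 /\ z = ev P / ev Q.
Proof.
have [e [a ->]] := perf_rootP z; exists e.
have evE (S : {poly 'F_2}) :
    \sum_(i < size S) (nat_of_ord S`_i)%:R * uroot e ^+ i
      = perf_root F2u_pchar e S%:F.
  rewrite -[in RHS](coefK S) poly_def !rmorph_sum /=; apply: eq_bigr => i _ /=.
  rewrite -mul_polyC !rmorphM !rmorphXn /=; congr (_ * _).
  by rewrite -{2}[S`_i]natr_Zp !rmorph_nat.
elim/quotW: a => x; exists (\n_x), (\d_x); rewrite /= !evE.
have d_neq0 : (\d_x)%:F != 0 :> F2u by rewrite tofrac_eq0 denom_ratioP.
rewrite fmorph_eq0 -fmorphV -rmorphM; split=> //; congr (perf_root _ _ _).
apply: (mulIf d_neq0); rewrite divfK //.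
rewrite -[LHS]/(FracField.mul _ _) !piE; apply/eqP.
rewrite FracField.equivf_def /FracField.mulf.
by rewrite !numden_Ratio ?mulr1 ?oner_neq0 ?denom_ratioP // mulrC.
Qed.

(* A power series is its family of coefficients; its product is given by the
   formula mcoeffM of {mpoly R[n]}. *)
Record mfps (n : nat) (R : Type) := MFps { fcoef : 'X_{1..n} -> R }.
HB.instance Definition _ n R := [isNew for @fcoef n R].
HB.instance Definition _ n (R : choiceType) := [Choice of mfps n R by <:].

Section PowerSeries.
Variables (n : nat) (R : comNzRingType).
Implicit Types f g h : mfps n R.

Lemma fpsP f g : fcoef f =1 fcoef g -> f = g.
Proof. by move=> fg; apply/val_inj/funext. Qed.

Definition fps_of_mpoly (q : {mpoly R[n]}) : mfps n R := MFps (fun m => q@_m).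

Definition fps_add f g := MFps (fun m => fcoef f m + fcoef g m).
Definition fps_opp f := MFps (fun m => - fcoef f m).
Definition fps_zero : mfps n R := MFps (fun=> 0).
Definition fps_one : mfps n R := MFps (fun m => (m == 0%MM)%:R).
Definition fps_mul f g := MFps (fun m =>
  \sum_(l : 'X_{1..n < (mdeg m).+1, (mdeg m).+1} | m == (l.1 + l.2)%MM)
    fcoef f l.1 * fcoef g l.2).

Lemma fps_addA : associative fps_add.
Proof. by move=> f g h; apply: fpsP => m /=; rewrite addrA. Qed.
Lemma fps_addC : commutative fps_add.
Proof. by move=> f g; apply: fpsP => m /=; rewrite addrC. Qed.
Lemma fps_add0 : left_id fps_zero fps_add.
Proof. by move=> f; apply: fpsP => m /=; rewrite add0r. Qed.
Lemma fps_addN : left_inverse fps_zero fps_opp fps_add.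
Proof. by move=> f; apply: fpsP => m /=; rewrite addNr. Qed.
HB.instance Definition _ :=
  GRing.isZmodule.Build (mfps n R) fps_addA fps_addC fps_add0 fps_addN.

Definition fps_trunc d f : {mpoly R[n]} :=
  \sum_(m : 'X_{1..n < d}) fcoef f m *: 'X_[m].

Lemma fps_truncE d f m : (mdeg m < d)%N -> (fps_trunc d f)@_m = fcoef f m.
Proof. exact: mcoeff_mpoly. Qed.

Lemma fps_mul_truncl d f g m : (mdeg m < d)%N ->
  fcoef (fps_mul f g) m = (fps_trunc d f * fps_trunc d g)@_m.
Proof.
move=> lt_md; rewrite mcoeffM; apply: eq_bigr => -[l1 l2] _ /=.
by rewrite !fps_truncE // (leq_trans (bmdeg _)).
Qed.

Lemma fps_mul_trunc2 d f g q r m : (mdeg m < d)%N ->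
    (forall l, (mdeg l < d)%N -> fcoef f l = q@_l) ->
    (forall l, (mdeg l < d)%N -> fcoef g l = r@_l) ->
  fcoef (fps_mul f g) m = (q * r)@_m.
Proof.
move=> lt_md fq gr; rewrite mcoeffM; apply: eq_bigr => -[l1 l2] _ /=.
by rewrite fq ?gr // (leq_trans (bmdeg _)).
Qed.

Lemma fps_mulA : associative fps_mul.
Proof.
move=> f g h; apply: fpsP => m; have lt_md := ltnSn (mdeg m).
set d := (mdeg m).+1 in lt_md; have tr := fun f l lt_l => esym (@fps_truncE d f l lt_l).
rewrite (@fps_mul_trunc2 d _ _ (fps_trunc d f) (fps_trunc d g * fps_trunc d h)) //;
  [|exact: tr|by move=> l ?; apply: fps_mul_truncl].
rewrite (@fps_mul_trunc2 d _ _ (fps_trunc d f * fps_trunc d g) (fps_trunc d h)) //;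
  [|by move=> l ?; apply: fps_mul_truncl|exact: tr].
by rewrite mulrA.
Qed.

Lemma fps_mulC : commutative fps_mul.
Proof.
move=> f g; apply: fpsP => m.
by rewrite !(@fps_mul_truncl (mdeg m).+1) // mulrC.
Qed.

Lemma fps_mul1 : left_id fps_one fps_mul.
Proof.
move=> f; apply: fpsP => m; have lt_md := ltnSn (mdeg m).
rewrite (@fps_mul_trunc2 _ _ _ 1 (fps_trunc (mdeg m).+1 f) m lt_md).
- by rewrite mul1r fps_truncE.
- by move=> l _; rewrite mcoeff1.
- by move=> l ?; rewrite fps_truncE.
Qed.

Lemma fps_mulDl : left_distributive fps_mul fps_add.
Proof.
move=> f g h; apply: fpsP => m /=; rewrite -big_split /=.
by apply: eq_bigr => l _; rewrite mulrDl.
Qed.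

Lemma fps_1neq0 : fps_one != 0.
Proof.
apply/eqP => /(congr1 (fun f => fcoef f 0%MM)) /= /eqP.
by rewrite eqxx oner_eq0.
Qed.

HB.instance Definition _ := GRing.Zmodule_isComNzRing.Build (mfps n R)
  fps_mulA fps_mulC fps_mul1 fps_mulDl fps_1neq0.

Definition fpsC (c : R) : mfps n R := fps_of_mpoly c%:MP.
Definition fpsX (i : 'I_n) : mfps n R := fps_of_mpoly 'X_i.

Lemma fps_of_mpoly_is_zmod_morphism : zmod_morphism fps_of_mpoly.
Proof. by move=> q r; apply: fpsP => m /=; rewrite mcoeffB. Qed.
HB.instance Definition _ := GRing.isZmodMorphism.Build {mpoly R[n]} (mfps n R)
  fps_of_mpoly fps_of_mpoly_is_zmod_morphism.

Lemma fps_of_mpoly_is_monoid_morphism : monoid_morphism fps_of_mpoly.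
Proof.
split=> [|q r]; apply: fpsP => m /=; first by rewrite mcoeff1.
by rewrite mcoeffM.
Qed.
HB.instance Definition _ := GRing.isMonoidMorphism.Build {mpoly R[n]} (mfps n R)
  fps_of_mpoly fps_of_mpoly_is_monoid_morphism.

Lemma fps_coef0M f g : fcoef (f * g) 0%MM = fcoef f 0%MM * fcoef g 0%MM.
Proof.
rewrite [LHS](@fps_mul_truncl 1) ?mdeg0 // mcoeff0_is_multiplicative.
by rewrite !fps_truncE ?mdeg0.
Qed.

End PowerSeries.

Definition is_domain (R : comNzRingType) : Prop := GRing.integral_domain_axiom R.

Definition fg_module (R : comNzRingType) (M : lmodType R) : Prop :=
  exists (n : nat) (g : 'I_n -> M),
    forall v, exists c : 'I_n -> R, v = \sum_i c i *: g i.

(* ideals are the submodules of R^o; in contrast idealr_closed, used below for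
   prime and maximal ideals, excludes the unit ideal *)
Definition noetherian (R : comNzRingType) : Prop :=
  forall I : {pred R^o}, submod_closed I ->
    exists (n : nat) (g : 'I_n -> R), (forall i, g i \in I) /\
      forall x, x \in I -> exists c : 'I_n -> R, x = \sum_i c i * g i.

Definition prime_ideal (R : comNzRingType) (P : {pred R}) : Prop :=
  idealr_closed P /\ prime_idealr_closed P.

Definition prime_chain (R : comNzRingType) (d : nat) : Prop :=
  exists P : nat -> {pred R},
    (forall i, (i <= d)%N -> prime_ideal (P i)) /\
    (forall i, (i < d)%N ->
       {subset P i <= P i.+1} /\ exists2 x, x \in P i.+1 & x \notin P i).

Definition krull_dim_eq (R : comNzRingType) (d : nat) : Prop :=
  prime_chain R d /\ forall d', prime_chain R d' -> (d' <= d)%N.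

Definition maximal_ideal (R : comNzRingType) (m : {pred R}) : Prop :=
  idealr_closed m /\
  forall J : {pred R}, idealr_closed J -> {subset m <= J} -> J =i m.

Definition in_ideal_pow (R : comNzRingType) (m : {pred R}) (n : nat) (x : R) :
    Prop :=
  exists (r : nat) (c : 'I_r -> R) (a : 'I_r -> 'I_n -> R),
    (forall i j, a i j \in m) /\ x = \sum_(i < r) c i * \prod_(j < n) a i j.

Definition adic_complete (R : comNzRingType) (m : {pred R}) : Prop :=
  (forall x, (forall n, in_ideal_pow m n x) -> x = 0) /\
  (forall s : nat -> R,
     (forall n, exists N, forall i j, (N <= i)%N -> (N <= j)%N ->
        in_ideal_pow m n (s i - s j)) ->
     exists l, forall n, exists N, forall i, (N <= i)%N ->
        in_ideal_pow m n (s i - l)).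

Definition complete_local (R : comNzRingType) : Prop :=
  noetherian R /\
  exists m : {pred R},
    [/\ maximal_ideal m,
        forall m' : {pred R}, maximal_ideal m' -> m' =i m
      & adic_complete m].

(* the R-module ^eM, on which r acts as multiplication by r^(p^e) *)
Definition frob (R : comNzRingType) (p : nat) (charRp : p \in [pchar R])
  (e : nat) (M : Type) : Type := M.

Section Frob.
Variables (R : comNzRingType) (p : nat) (charRp : p \in [pchar R]).
Variables (e : nat) (M : lmodType R).
HB.instance Definition _ := GRing.Zmodule.copy (frob charRp e M) M.

Definition frob_scale (r : R) (v : frob charRp e M) : frob charRp e M :=
  (r ^+ (p ^ e) *: (v : M)).

Lemma frob_scaleA r s v : frob_scale r (frob_scale s v) = frob_scale (r * s) v.
Proof. by rewrite /frob_scale exprMn -scalerA. Qed.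
Lemma frob_scale1 : left_id 1 frob_scale.
Proof. by move=> v; rewrite /frob_scale expr1n scale1r. Qed.
Lemma frob_scaleDr : right_distributive frob_scale +%R.
Proof. by move=> r v w; apply: (scalerDr (r ^+ (p ^ e)) (v : M)). Qed.
Lemma frob_scaleDl v : {morph frob_scale^~ v : r s / r + s}.
Proof. by move=> r s; rewrite /frob_scale (powD charRp) [LHS]scalerDl. Qed.
HB.instance Definition _ := GRing.Zmodule_isLmodule.Build R (frob charRp e M)
  frob_scaleA frob_scale1 frob_scaleDr frob_scaleDl.
End Frob.

Definition dsum (I : finType) (M : I -> Type) : Type := {dffun forall i, M i}.

Section DirectSum.
Variables (R : comNzRingType) (I : finType) (M : I -> lmodType R).
Implicit Types v w : dsum M.
HB.instance Definition _ := Choice.copy (dsum M) {dffun forall i, M i}.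

Definition dsum_zero : dsum M := [ffun i => 0].
Definition dsum_add v w : dsum M := [ffun i => v i + w i].
Definition dsum_opp v : dsum M := [ffun i => - v i].
Definition dsum_scale r v : dsum M := [ffun i => r *: v i].

Lemma dsum_addA : associative dsum_add.
Proof. by move=> v w x; apply/ffunP => i; rewrite !ffunE addrA. Qed.
Lemma dsum_addC : commutative dsum_add.
Proof. by move=> v w; apply/ffunP => i; rewrite !ffunE addrC. Qed.
Lemma dsum_add0 : left_id dsum_zero dsum_add.
Proof. by move=> v; apply/ffunP => i; rewrite !ffunE add0r. Qed.
Lemma dsum_addN : left_inverse dsum_zero dsum_opp dsum_add.
Proof. by move=> v; apply/ffunP => i; rewrite !ffunE addNr. Qed.
HB.instance Definition _ :=
  GRing.isZmodule.Build (dsum M) dsum_addA dsum_addC dsum_add0 dsum_addN.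

Lemma dsum_scaleA r s v : dsum_scale r (dsum_scale s v) = dsum_scale (r * s) v.
Proof. by apply/ffunP => i; rewrite !ffunE scalerA. Qed.
Lemma dsum_scale1 : left_id 1 dsum_scale.
Proof. by move=> v; apply/ffunP => i; rewrite !ffunE scale1r. Qed.
Lemma dsum_scaleDr : right_distributive dsum_scale +%R.
Proof. by move=> r v w; apply/ffunP => i; rewrite !ffunE scalerDr. Qed.
Lemma dsum_scaleDl v : {morph dsum_scale^~ v : r s / r + s}.
Proof. by move=> r s; apply/ffunP => i; rewrite !ffunE scalerDl. Qed.
HB.instance Definition _ := GRing.Zmodule_isLmodule.Build R (dsum M)
  dsum_scaleA dsum_scale1 dsum_scaleDr dsum_scaleDl.
End DirectSum.

Definition lmod_iso (R : comNzRingType) (U V : lmodType R) : Prop :=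
  exists f : {linear U -> V}, bijective f.

(* The summands of ^eR are indexed by the pairs (i, j) with j < n_i. *)
Definition finite_F_rep_type (R : comNzRingType) (p : nat)
    (charRp : p \in [pchar R]) : Prop :=
  exists (s : nat) (M : 'I_s -> lmodType R),
    (forall i, fg_module (M i)) /\
    forall e : nat, exists n : 'I_s -> nat,
      lmod_iso (frob charRp e R^o)
               (dsum (fun ij : {i : 'I_s & 'I_(n i)} => M (tag ij))).

(* V is the internal direct sum of the subgroups G a *)
Definition is_grading (T : eqType) (V : zmodType) (G : T -> {pred V}) : Prop :=
  [/\ forall a, zmod_closed (G a),
      forall v, exists (s : seq T) (c : T -> V),
        [/\ uniq s, forall a, c a \in G a & v = \sum_(a <- s) c a]
    & forall (s : seq T) (c : T -> V), uniq s -> (forall a, c a \in G a) ->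
        \sum_(a <- s) c a = 0 -> forall a, a \in s -> c a = 0].

Definition graded_ring (R : comNzRingType) (G : nat -> {pred R}) : Prop :=
  [/\ is_grading G, 1 \in G 0%N
    & forall a b x y, x \in G a -> y \in G b -> x * y \in G (a + b)%N].

Definition Qgraded_module (R : comNzRingType) (G : nat -> {pred R})
    (M : lmodType R) (H : rat -> {pred M}) : Prop :=
  is_grading H /\
  forall a b x v, x \in G a -> v \in H b -> x *: v \in H (a%:R + b).

(* an N-graded ring as a Z-graded module over itself *)
Definition ring_Zgrading (R : comNzRingType) (G : nat -> {pred R}) (z : int) :
    {pred R^o} :=
  if z is Posz n then G n else pred1 0.

Definition frob_grading (R : comNzRingType) (p : nat)
    (charRp : p \in [pchar R]) (e : nat) (M : lmodType R) (H : int -> {pred M})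
    (a : rat) : {pred frob charRp e M} :=
  let b := (p ^ e)%:R * a in if b \is a Num.int then H (numq b) else pred1 0.

Definition shift_grading (V : zmodType) (H : rat -> {pred V}) (a b : rat) :
    {pred V} := H (a + b).

Definition dsum_grading (R : comNzRingType) (I : finType) (M : I -> lmodType R)
    (H : forall i, rat -> {pred M i}) (a : rat) : {pred dsum M} :=
  [pred v : dsum M | [forall i, v i \in H i a]].

Definition graded_iso (R : comNzRingType) (U V : lmodType R)
    (HU : rat -> {pred U}) (HV : rat -> {pred V}) : Prop :=
  exists f : {linear U -> V}, bijective f /\
    forall a v, (f v \in HV a) = (v \in HU a).

Definition finite_graded_F_rep_type (R : comNzRingType) (p : nat)
    (charRp : p \in [pchar R]) (G : nat -> {pred R}) : Prop :=
  exists (s : nat) (M : 'I_s -> lmodType R) (H : forall i, rat -> {pred M i}),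
    (forall i, fg_module (M i) /\ Qgraded_module G (H i)) /\
    forall e : nat, exists (n : 'I_s -> nat) (a : forall i, 'I_(n i) -> rat),
      graded_iso (@frob_grading R p charRp e R^o (ring_Zgrading G))
        (dsum_grading (fun ij : {i : 'I_s & 'I_(n i)} =>
           shift_grading (H (tag ij)) (a (tag ij) (tagged ij)))).

Definition quartic (R : comNzRingType) (c x y : R) : R :=
  x ^+ 4 + x ^+ 2 * y ^+ 2 + c * x * y ^+ 3 + y ^+ 4.

Lemma rmorph_quartic (R S : comNzRingType) (f : {rmorphism R -> S}) (c x y : R) :
  f (quartic c x y) = quartic (f c) (f x) (f y).
Proof. by rewrite /quartic !(rmorphD, rmorphXn, rmorphM). Qed.

Definition in_principal (R : comNzRingType) (f : R) : pred R :=
  fun g => `[< exists h, g = h * f >].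

Lemma in_principal_closed (R : comNzRingType) (f : R) :
  (forall h, h * f != 1) -> idealr_closed (in_principal f).
Proof.
move=> f_nunit; split.
- by apply/asboolP; exists 0; rewrite mul0r.
- by apply/asboolP => -[h /esym/eqP]; rewrite (negPf (f_nunit h)).
- move=> a x y /asboolP[h ->] /asboolP[h' ->].
  by apply/asboolP; exists (a * h + h'); rewrite mulrDl mulrA.
Qed.

Section QuarticRings.
Variables (F : fieldType) (c : F).

Definition quart_mpoly : {mpoly F[2]} := quartic c%:MP 'X_ord0 'X_ord_max.
Definition quart_fps : mfps 2 F :=
  quartic (fpsC 2 c) (fpsX F ord0) (fpsX F ord_max).

Lemma quart_fpsE : quart_fps = fps_of_mpoly quart_mpoly.
Proof. by rewrite /quart_mpoly rmorph_quartic. Qed.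

Lemma quart_coef0 : quart_mpoly@_0%MM = 0.
Proof.
have X0 (i : 'I_2) : 'X_i@_0%MM = 0 :> F.
  by rewrite mcoeffX -mdeg_eq0 mdeg1.
rewrite /quart_mpoly (rmorph_quartic (mcoeff 0%MM)) /= !X0.
by rewrite /quartic !expr0n !(mulr0, addr0).
Qed.

Lemma quart_mpoly_nunit (h : {mpoly F[2]}) : h * quart_mpoly != 1.
Proof.
apply/eqP => /(congr1 (mcoeff 0%MM)) /eqP.
rewrite (rmorphM (mcoeff 0%MM)) /= quart_coef0 mulr0 mcoeff1 eqxx.
by rewrite eq_sym oner_eq0.
Qed.

Lemma quart_fps_nunit (h : mfps 2 F) : h * quart_fps != 1.
Proof.
apply/eqP => /(congr1 (fun f => fcoef f 0%MM)) /eqP.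
by rewrite fps_coef0M quart_fpsE /= quart_coef0 mulr0 eqxx eq_sym oner_eq0.
Qed.

Definition in_quart_mpoly : pred {mpoly F[2]} := in_principal quart_mpoly.
HB.instance Definition _ := isIdealr.Build {mpoly F[2]} in_quart_mpoly
  (in_principal_closed quart_mpoly_nunit).
Definition ideal_mpoly : idealr {mpoly F[2]} := in_quart_mpoly.

Definition in_quart_fps : pred (mfps 2 F) := in_principal quart_fps.
HB.instance Definition _ := isIdealr.Build (mfps 2 F) in_quart_fps
  (in_principal_closed quart_fps_nunit).
Definition ideal_fps : idealr (mfps 2 F) := in_quart_fps.

(* F[x,y] / (x^4 + x^2 y^2 + c x y^3 + y^4) and
   F[[x,y]] / (x^4 + x^2 y^2 + c x y^3 + y^4) *)
Definition quot_mpoly : comNzRingType := {ideal_quot ideal_mpoly}.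
Definition quot_fps : comNzRingType := {ideal_quot ideal_fps}.

(* the degree n part, where deg x = deg y = 1 *)
Definition quot_grading (n : nat) : {pred quot_mpoly} :=
  fun a => `[< exists2 q : {mpoly F[2]},
                 q \is n.-homog & a = \pi_({ideal_quot ideal_mpoly}) q >].

Variable charF2 : 2%N \in [pchar F].

Lemma quot_mpoly_pchar : 2%N \in [pchar quot_mpoly].
Proof.
apply: (rmorph_pchar (\pi_({ideal_quot ideal_mpoly}))).
exact: (rmorph_pchar (@mpolyC 2 F)) charF2.
Qed.

Lemma quot_fps_pchar : 2%N \in [pchar quot_fps].
Proof.
apply: (rmorph_pchar (\pi_({ideal_quot ideal_fps}))).
apply: (rmorph_pchar (@fps_of_mpoly 2 F)).
exact: (rmorph_pchar (@mpolyC 2 F)) charF2.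
Qed.

End QuarticRings.

Definition ringA : comNzRingType := quot_mpoly uperf.
Definition gradA : nat -> {pred ringA} := @quot_grading kperf uperf.
Definition ringAhat : comNzRingType := quot_fps uperf.

Lemma ringA_pchar : 2%N \in [pchar ringA].
Proof. exact: quot_mpoly_pchar kperf_pchar. Qed.

Lemma ringAhat_pchar : 2%N \in [pchar ringAhat].
Proof. exact: quot_fps_pchar kperf_pchar. Qed.

(* Main.v *)
Require Import Defs.
From HB Require Import structures.
From mathcomp Require Import all_boot all_algebra.
From mathcomp Require Import all_field.
From mathcomp Require Import boolp zify ring.
From mathcomp.multinomials Require Import mpoly.

Set Implicit Arguments.
Unset Strict Implicit.
Unset Printing Implicit Defensive.

Import GRing.Theory.
Local Open Scope ring_scope.
Local Open Scope quotient_scope.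

(** Put t = x / y. In degree d the ring A is y^d times the span of
    1, t, ..., t^min(d, 3), so A and its completion both embed in L[[y]], where
    L = k[t] / (t^4 + t^2 + u t + 1) is an extension of k of degree 4, and in
    degrees d >= 3 they contain all of L y^d. The record [expansion] keeps only
    this: coefficient functions co n : R -> L that multiply by the Cauchy formula,
    vanish together only at 0, and take their values in k for n = 0 and in
    k + k t for n = 1. The two rings are treated together through it.

    The quotient by any nonzero element has finite dimension over k, because
    division by the leading (or lowest) form is possible in degrees >= 3; this
    yields noetherianity and dimension one, and for the completion a limit taken
    coefficientwise lies in the ring as soon as its first three coefficients do.

    For the representation type, let q = 2^e. If every eR were a sum of copies of
    finitely many finitely generated modules, then one of them, say M, would for
    infinitely many e admit maps f_e : eR -> M and g_e : M -> eR such that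
    g_e (f_e y) has a nonzero coefficient of degree 1: the identity of eR is a sum
    of such composites, and y has coefficient 1. For e <> e' the coefficient of
    degree 1 of g_e' (f_e y) vanishes (lemma [cross_coef1]). Indeed if s^q = t and P
    is the cubic form with P(t, 1) = s, then P^q y = y^(3q) x, and pushing this
    relation through f_e and g_e' shows that multiplication by s^q' sends that
    coefficient, an element of k + k t, into k + k t. If it were nonzero, s^q' would
    be a Moebius transform of t over k; but s^q' and t are roots of the quartics
    X^4 + X^2 + W X + 1 with W = u^(q'/q) and W = u respectively, and these two
    quartics are not equivalent under Moebius substitutions
    (lemma [not_moebius]). Hence the elements f_e y are linearly independent
    modulo the maximal ideal of R, for infinitely many e, and M cannot be finitely
    generated.

    The quartic is irreducible over k: a factorization into quadratics gives a root
    of the resolvent a^3 + a = u, that is a rational function with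
    a^3 + a = u^(2^e), impossible since 3 does not divide 2^e; a root is excluded by
    setting u = 0, where the quartic form has no nontrivial zero over F_2. *)

Lemma mx_dependence (F : fieldType) m n (A : 'M[F]_(m, n)) : (n < m)%N ->
  exists c : 'I_m -> F,
    (exists i, c i != 0) /\ forall j, \sum_i c i * A i j = 0.
Proof.
move=> lt_nm; have kerA0 : kermx A != 0.
  by rewrite kermx_eq0 /row_free neq_ltn (leq_ltn_trans (rank_leq_col A)).
have [i [j Kij]] : exists i j, kermx A i j != 0.
  apply: contrapT => K0; case/eqP: kerA0; apply/matrixP => i j; rewrite [RHS]mxE.
  by apply/eqP/contraT => Kij; case: K0; exists i, j.
exists (fun j => kermx A i j); split; first by exists j.
move=> l; have /matrixP/(_ i l) := mulmx_ker A.
by rewrite mxE [RHS]mxE.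
Qed.

(** * Rings whose proper quotients are finite-dimensional *)

Section FiniteCodimension.
Variables (F : fieldType) (R : comNzRingType) (cst : {rmorphism F -> R}).

(** dim (R / a R) < N over F, phrased by linear dependence so that no quotient
    vector space has to be formed. *)
Definition finite_codim (a : R) :=
  exists N, forall r : 'I_N -> R, exists c : 'I_N -> F,
    (exists i, c i != 0) /\ exists z, \sum_i cst (c i) * r i = a * z.

Hypothesis codimR : forall a : R, a != 0 -> finite_codim a.

(** A nonzero a in I together with a maximal family of elements of I that is
    linearly independent modulo a generates I. *)
Lemma finite_codim_noetherian : noetherian R.
Proof.
move=> I [I0 Ilin].
have IM (r v : R) : v \in I -> r * v \in I.
  by move=> Iv; have := Ilin r v 0 Iv I0; rewrite addr0.
have ID (v w : R) : v \in I -> w \in I -> v + w \in I.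
  by move=> Iv Iw; have := Ilin 1 v w Iv Iw; rewrite scale1r.
have [[a Ia a0]|I_eq0] := pselect (exists2 a : R, a \in I & a != 0); last first.
  exists 0%N, (fun=> 0); split=> [[]//|v Iv]; exists (fun=> 0); rewrite big_ord0.
  by apply/eqP/contraT => v0; case: I_eq0; exists v.
have [N codima] := codimR a0.
pose P n := `[< exists g : 'I_n -> R, (forall i, g i \in I) /\
  forall c z, \sum_i cst (c i) * g i = a * z -> forall i, c i = 0 >].
have P0 : exists n, P n.
  by exists 0%N; apply/asboolP; exists (fun=> 0); split=> [[]|c z _ []].
have PN n : P n -> (n <= N)%N.
  move=> /asboolP[g [_ free_g]]; rewrite leqNgt; apply/negP => lt_Nn.
  have le_Nn := ltnW lt_Nn.
  have [c [[i ci0] [z cz]]] := codima (fun i => g (widen_ord le_Nn i)).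
  pose c' (j : 'I_n) := if insub (j : nat) is Some i then c i else 0.
  have c'E i' : c' (widen_ord le_Nn i') = c i' by rewrite /c' valK.
  case/eqP: ci0; rewrite -c'E; apply: (free_g c' z); rewrite -cz.
  rewrite (bigID (fun j : 'I_n => j < N)%N) /= [X in _ + X]big1 ?addr0; last first.
    by move=> j ltjN; rewrite /c' insubN // rmorph0 mul0r.
  rewrite (big_ord_narrow le_Nn).
  by apply: eq_bigr => j _; rewrite c'E.
have [m /asboolP[g [Ig free_g]] max_m] := ex_maxnP P0 PN.
exists m.+1, (fun i => if unlift ord0 i is Some j then g j else a); split.
  by move=> i; case: unliftP.
move=> v Iv.
have [c [z [cz cn0]]] : exists (c : 'I_m.+1 -> F) (z : R),
    cst (c ord0) * v + \sum_(i < m) cst (c (lift ord0 i)) * g i = a * z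
    /\ c ord0 != 0.
  apply: contrapT => no_c; suff : P m.+1 by move/max_m; rewrite ltnn.
  apply/asboolP; exists (fun i => if unlift ord0 i is Some j then g j else v).
  split=> [i|c z cz]; first by case: unliftP.
  have {}cz : cst (c ord0) * v + \sum_(i < m) cst (c (lift ord0 i)) * g i = a * z.
    rewrite -cz big_ord_recl unlift_none; congr (_ + _).
    by apply: eq_bigr => i _; rewrite liftK.
  have c0 : c ord0 = 0.
    by apply/eqP/contraT => c0; case: no_c; exists c, z.
  move=> i; case: (unliftP ord0 i) => [j ->|-> //].
  move: cz; rewrite c0 rmorph0 mul0r add0r => cz.
  exact: (free_g (fun j => c (lift ord0 j)) z).
pose b := cst (c ord0)^-1.
exists (fun i => if unlift ord0 i is Some j then - b * cst (c (lift ord0 j)) else b * z).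
rewrite big_ord_recl unlift_none.
under eq_bigr do rewrite !liftK.
have bc : b * cst (c ord0) = 1 by rewrite -rmorphM mulVf ?rmorph1.
rewrite -[LHS]mul1r -bc -!mulrA [z * a]mulrC -cz mulrDr -addrA.
rewrite mulr_sumr -big_split /= big1 ?addr0 // => i _.
by rewrite !mulNr mulrA subrr.
Qed.

(** Given primes P0 < P1 < P2, take r nonzero in P1 and b in P2 but not in P1. The
    powers of b are dependent modulo r, so p(b) lies in P1 for some nonzero
    polynomial p; cancelling powers of b, the constant term of p may be assumed
    nonzero, and then P2 contains a unit. *)
Lemma finite_codim_dim1 (m : {pred R}) (a : R) :
  is_domain R -> prime_ideal m -> a \in m -> a != 0 -> krull_dim_eq R 1.
Proof.
move=> domR pm am a0; split.
  exists (fun i => if i is 0%N then pred1 0 : {pred R} else m); split.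
    case=> [|i] _ //; split; last by move=> u v; rewrite !inE => /eqP; apply: domR.
    split=> [||r u v]; rewrite !inE ?oner_eq0 // => /eqP-> /eqP->.
    by rewrite mulr0 addr0.
  case=> // _; split; last by exists a; rewrite ?inE.
  by move=> u; rewrite inE => /eqP ->; case: pm => -[].
move=> d [P [primeP chainP]]; rewrite leqNgt; apply/negP => lt1d.
have [idP0 _] := primeP 0%N (leq0n _).
have [idP1 prP1] := primeP 1%N (ltnW lt1d).
have [idP2 _] := primeP 2%N lt1d.
have [_ [r r1 r0]] := chainP 0%N (ltnW lt1d).
have [sP12 [b b2 b1]] := chainP 1%N lt1d.
have rn0 : r != 0 by apply: contraNneq r0 => ->; case: idP0.
have idM (Q : {pred R}) : idealr_closed Q -> forall u v, v \in Q -> u * v \in Q.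
  by move=> [Q0 _ Qlin] u v Qv; have := Qlin u v 0 Qv Q0; rewrite addr0.
have cstP2 c : c != 0 -> cst c \notin P 2%N.
  move=> c0; apply/negP => /(idM _ idP2 (cst c^-1)).
  rewrite -rmorphM mulVf // rmorph1; apply/negP.
  by case: idP2.
(* No nonzero polynomial takes b into P1. *)
have key (p : {poly F}) : p != 0 -> (map_poly cst p).[b] \notin P 1%N.
  elim/poly_ind: p => [|p c IHp]; first by rewrite eqxx.
  rewrite rmorphD rmorphM /= map_polyX map_polyC !hornerE /=.
  have [->|c0 _] := eqVneq c 0.
    rewrite !rmorph0 !addr0 mulf_eq0 polyX_eq0 orbF => /IHp pb1.
    by apply/negP => P1pb; have := prP1 _ _ P1pb; rewrite (negPf b1) (negPf pb1).
  apply: contra (cstP2 _ c0) => /sP12 Pbc.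
  case: (idP2) => _ _ /(_ (- (map_poly cst p).[b]) b _ b2 Pbc).
  by rewrite mulNr addKr.
have [N /(_ (fun i => b ^+ i))[c [[i ci] [z cz]]]] := codimR rn0.
pose p := \poly_(j < N) (if insub j is Some i' then c i' else 0).
have pE (j : 'I_N) : p`_j = c j by rewrite coef_poly ltn_ord valK.
have pn0 : p != 0.
  by apply/negP => /eqP p0; move: ci; rewrite -pE p0 coef0 eqxx.
have /negP := key p pn0; apply.
rewrite (@horner_coef_wide _ N); last first.
  by rewrite (leq_trans (size_poly _ _)) // size_poly.
under eq_bigr do rewrite coef_map pE.
by rewrite cz mulrC idM.
Qed.

End FiniteCodimension.

(** * Rings embedded in L[[y]] *)

(** co n r is the coefficient of y^n in the image of r, and x maps to t y. *)
Record expansion (F : fieldType) (L : fieldExtType F) (t : L) (R : comNzRingType)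
    (cst : {rmorphism F -> R}) (x y : R) (co : nat -> R -> L) : Prop := Expansion {
  coB : forall n, zmod_morphism (co n);
  coM : forall n r s, co n (r * s) = \sum_(i < n.+1) co i r * co (n - i)%N s;
  co_cst : forall n c, co n (cst c) = (if n == 0%N then c%:A else 0);
  co_x : forall n, co n x = (if n == 1%N then t else 0);
  co_y : forall n, co n y = (if n == 1%N then 1 else 0);
  co_deg0 : forall r, exists a, co 0%N r = a%:A;
  co_deg1 : forall r, exists a b, co 1%N r = a%:A + b *: t;
  co_inj : forall r, (forall n, co n r = 0) -> r = 0 }.

Section Expansion.
Variables (F : fieldType) (L : fieldExtType F) (t : L) (R : comNzRingType).
Variables (cst : {rmorphism F -> R}) (x y : R) (co : nat -> R -> L).
Hypothesis coE : expansion t cst x y co.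
Hypothesis span_t : forall z : L, exists a : 'I_4 -> F, z = \sum_i a i *: t ^+ i.

HB.instance Definition _ n := GRing.isZmodMorphism.Build R L (co n) (coB coE n).

Definition homog_at d (z : L) (r : R) :=
  forall n, co n r = (if n == d then z else 0).

Lemma homog_coM d z r s n : homog_at d z r -> co (d + n)%N (r * s) = z * co n s.
Proof.
move=> hr; rewrite (coM coE).
have ltd : (d < (d + n).+1)%N by rewrite ltnS leq_addr.
rewrite (bigD1 (Ordinal ltd)) //= big1 ?addr0 => [|i neq_id].
  by rewrite hr eqxx addKn.
by rewrite hr -[i == d :> nat]/(i == Ordinal ltd) (negPf neq_id) mul0r.
Qed.

Lemma homog_coM_lt d z r s n : homog_at d z r -> (n < d)%N -> co n (r * s) = 0.
Proof.
move=> hr lt_nd; rewrite (coM coE) big1 // => i _; rewrite hr ltn_eqF ?mul0r //.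
by rewrite (leq_ltn_trans _ lt_nd) // -ltnS.
Qed.

Lemma homogM d e z w r s :
  homog_at d z r -> homog_at e w s -> homog_at (d + e)%N (z * w) (r * s).
Proof.
move=> hr hs n; have [le_dn|lt_nd] := leqP d n; last first.
  by rewrite (homog_coM_lt _ hr lt_nd) ltn_eqF // (leq_trans lt_nd) ?leq_addr.
rewrite -(subnKC le_dn) (homog_coM _ _ hr) hs eqn_add2l.
by case: eqP => _; rewrite ?mulr0.
Qed.

Lemma homog_cst c : homog_at 0 c%:A (cst c). Proof. by move=> n; rewrite (co_cst coE). Qed.
Lemma homog_x : homog_at 1 t x. Proof. exact: co_x coE. Qed.
Lemma homog_y : homog_at 1 1 y. Proof. exact: co_y coE. Qed.

Lemma homog_cstM d z r c : homog_at d z r -> homog_at d (c *: z) (cst c * r).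
Proof. by move=> hr; have := homogM (homog_cst c) hr; rewrite mulr_algl. Qed.

Lemma homog_sum (I : finType) d (z : I -> L) (r : I -> R) :
  (forall i, homog_at d (z i) (r i)) -> homog_at d (\sum_i z i) (\sum_i r i).
Proof.
move=> hr n; rewrite raddf_sum /=; case: ifP => n_d.
  by apply: eq_bigr => i _; rewrite hr n_d.
by rewrite big1 // => i _; rewrite hr n_d.
Qed.

Lemma homogX d z r m : homog_at d z r -> homog_at (d * m)%N (z ^+ m) (r ^+ m).
Proof.
move=> hr; elim: m => [|m IHm].
  by rewrite muln0 !expr0; have := homog_cst 1; rewrite rmorph1 scale1r.
by rewrite mulnS !exprS; apply: homogM.
Qed.

Lemma homog_xy i j : homog_at (i + j)%N (t ^+ i) (x ^+ i * y ^+ j).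
Proof.
have := homogM (homogX i homog_x) (homogX j homog_y).
by rewrite !mul1n expr1n mulr1.
Qed.

Lemma homog_inj d z r s : homog_at d z r -> homog_at d z s -> r = s.
Proof.
move=> hr hs; apply/eqP; rewrite -subr_eq0; apply/eqP/(co_inj coE) => n.
by rewrite raddfB /= hr hs subrr.
Qed.

(** In degrees d >= 3 the monomials x^i y^(d - i) with i < 4 exist, and their
    coefficients 1, t, t^2, t^3 span L. *)
Lemma homog_exists d (z : L) : (3 <= d)%N -> exists r, homog_at d z r.
Proof.
move=> le3d; have [a ->] := span_t z.
exists (\sum_(i < 4) cst (a i) * (x ^+ i * y ^+ (d - i))).
apply: homog_sum => i; apply: homog_cstM.
have le_id : (i <= d)%N by rewrite (leq_trans _ le3d) // -ltnS.
by rewrite -{1}(subnKC le_id); apply: homog_xy.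
Qed.

Lemma co_cstM n c r : co n (cst c * r) = c *: co n r.
Proof. by rewrite -[n]add0n (homog_coM _ _ (homog_cst c)) mulr_algl. Qed.

Lemma co_low a b r s : (forall i, (i < a)%N -> co i r = 0) ->
    (forall i, (i < b)%N -> co i s = 0) ->
  forall n, (n < a + b)%N -> co n (r * s) = 0.
Proof.
move=> r0 s0 n lt_n; rewrite (coM coE) big1 // => i _.
have [/r0 ->|le_ai] := ltnP i a; first by rewrite mul0r.
by rewrite s0 ?mulr0 //; have := ltn_ord i; lia.
Qed.

Lemma co_lead a b r s : (forall i, (i < a)%N -> co i r = 0) ->
    (forall i, (i < b)%N -> co i s = 0) ->
  co (a + b)%N (r * s) = co a r * co b s.
Proof.
move=> r0 s0; rewrite (coM coE).
have lta : (a < (a + b).+1)%N by lia.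
rewrite (bigD1 (Ordinal lta)) //= addKn big1 ?addr0 // => i /eqP neq_ia.
have [/r0 ->|le_ai] := ltnP i a; first by rewrite mul0r.
have neq : nat_of_ord i <> a by move=> ia; apply/neq_ia/val_inj.
by rewrite s0 ?mulr0 //; have := ltn_ord i; lia.
Qed.

Lemma co_ord r : r != 0 ->
  exists2 d, co d r != 0 & forall i, (i < d)%N -> co i r = 0.
Proof.
move=> r0; have [|d co_d min_d] := @ex_minnP (fun n => co n r != 0).
  apply: contrapT => no_n; case/eqP: r0; apply: (co_inj coE) => n.
  by apply/eqP/contraT => nz; case: no_n; exists n.
exists d => // i; rewrite ltnNge => /negP lt_id.
by apply/eqP/contraT => /min_d.
Qed.

Lemma expansion_domain : is_domain R.
Proof.
move=> r s rs0; apply: contraT; rewrite negb_or => /andP[].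
move=> /co_ord[a ra r_lt] /co_ord[b sb s_lt].
have := co_lead r_lt s_lt; rewrite rs0 raddf0 => /esym/eqP.
by rewrite mulf_eq0 (negPf ra) (negPf sb).
Qed.

Definition irrelevant_ideal : {pred R} := [pred r | co 0 r == 0].

Lemma co0M r s : co 0 (r * s) = co 0 r * co 0 s.
Proof. by apply: (@co_lead 0 0). Qed.

Lemma irrelevant_prime : prime_ideal irrelevant_ideal.
Proof.
split; first split=> [||r u v]; rewrite ?inE ?raddf0 //.
- by rewrite -(rmorph1 cst) (co_cst coE) scaler_eq0 !oner_eq0.
- by move=> /eqP u0 /eqP v0; rewrite raddfD /= co0M u0 v0 mulr0 addr0.
- by move=> u v; rewrite !inE co0M mulf_eq0.
Qed.

Lemma irrelevant_y : y \in irrelevant_ideal.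
Proof. by rewrite inE (co_y coE). Qed.

Lemma y_neq0 : y != 0.
Proof.
by apply/eqP => /(congr1 (co 1)) /eqP; rewrite (co_y coE) raddf0 oner_eq0.
Qed.

Lemma expansion_dim1 :
  (forall a : R, a != 0 -> finite_codim cst a) -> krull_dim_eq R 1.
Proof.
move=> codimR; apply: (finite_codim_dim1 codimR) irrelevant_y y_neq0.
  exact: expansion_domain.
exact: irrelevant_prime.
Qed.

(** The first d coefficients of an element are 4 d scalars, as L has dimension at
    most 4. *)
Lemma low_dependence d (r : 'I_(4 * d).+1 -> R) :
  exists c : 'I_(4 * d).+1 -> F, (exists i, c i != 0) /\
    forall n, (n < d)%N -> co n (\sum_i cst (c i) * r i) = 0.
Proof.
have [a aE] : exists a : nat -> R -> 'I_4 -> F,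
    forall n r, co n r = \sum_j a n r j *: t ^+ j.
  have /choice[a aE] : forall nr : nat * R,
      exists a, co nr.1 nr.2 = \sum_(j < 4) a j *: t ^+ j.
    by move=> nr; apply: span_t.
  by exists (fun n r => a (n, r)) => n s; apply: (aE (n, s)).
pose A : 'M[F]_((4 * d).+1, #|{: 'I_4 * 'I_d}|) :=
  \matrix_(i, j) let p : 'I_4 * 'I_d := enum_val j in a p.2 (r i) p.1.
have [|c [c0 cA]] := mx_dependence A; first by rewrite card_prod !card_ord.
exists c; split=> // n lt_nd.
rewrite raddf_sum /=.
under eq_bigr do rewrite co_cstM aE scaler_sumr.
rewrite exchange_big big1 //= => j _.
under eq_bigr do rewrite scalerA.
rewrite -scaler_suml.
have := cA (enum_rank (j, Ordinal lt_nd)).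
under eq_bigr do rewrite mxE enum_rankK /=.
by move=> ->; rewrite scale0r.
Qed.

End Expansion.

(** * Finite F-representation type *)

Section Retracts.
Variables (R : comNzRingType) (p : nat) (charRp : p \in [pchar R]).

(** R-linear maps from eR to M, and from M to eR, as maps on R itself. *)
Definition frob_linear (e : nat) (M : lmodType R) (f : R -> M) :=
  (forall v w, f (v + w) = f v + f w) /\
  forall r v, f (r ^+ (p ^ e) * v) = r *: f v.

Definition linear_frob (e : nat) (M : lmodType R) (g : M -> R) :=
  (forall v w, g (v + w) = g v + g w) /\
  forall r v, g (r *: v) = r ^+ (p ^ e) * g v.

Definition dsum_inj (I : finType) (M : I -> lmodType R) (i : I) (v : M i) : dsum M :=
  [ffun j => dfwith (fun j => 0 : M j) v j].

Lemma dsum_injE (I : finType) (M : I -> lmodType R) (v : dsum M) :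
  v = \sum_i dsum_inj (v i).
Proof.
have sumE (J : finType) (w : J -> dsum M) j : (\sum_i w i) j = \sum_i w i j.
  elim/big_rec2: _ => [|i a b _ <-]; first by rewrite ffunE.
  by rewrite ffunE.
apply/ffunP => j; rewrite sumE (bigD1 j) //= ffunE dfwith_in big1 ?addr0 //.
by move=> i neq_ij; rewrite ffunE dfwith_out.
Qed.

Lemma dsum_injD (I : finType) (M : I -> lmodType R) (i : I) (v w : M i) :
  dsum_inj (v + w) = dsum_inj v + dsum_inj w.
Proof.
apply/ffunP => j; rewrite !ffunE.
have [<-|neq_ij] := eqVneq i j; first by rewrite !dfwith_in.
by rewrite !dfwith_out // addr0.
Qed.

Lemma dsum_injZ (I : finType) (M : I -> lmodType R) (i : I) r (v : M i) :
  dsum_inj (r *: v) = r *: dsum_inj v.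
Proof.
apply/ffunP => j; rewrite !ffunE.
have [<-|neq_ij] := eqVneq i j; first by rewrite !dfwith_in.
by rewrite !dfwith_out // scaler0.
Qed.

(** The decomposition of eR, read as a decomposition of its identity map into maps
    through the given modules. These composites can be compared for different e
    without any uniqueness of direct sum decompositions. *)
Lemma finite_F_rep_retracts : finite_F_rep_type charRp ->
  exists (s : nat) (M : 'I_s -> lmodType R), (forall i, fg_module (M i)) /\
    forall e, exists (J : finType) (tau : J -> 'I_s)
        (f : forall j, R -> M (tau j)) (g : forall j, M (tau j) -> R),
      [/\ forall j, frob_linear e (f j), forall j, linear_frob e (g j)
        & forall v, v = \sum_j g j (f j v)].
Proof.
move=> [s [M [fgM decM]]]; exists s, M; split=> // e.
have [n [h [h' hK h'K]]] := decM e.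
pose J : finType := {i : 'I_s & 'I_(n i)}.
pose MM := fun j : J => M (tag j).
have h'lin : linear h' by apply: can2_linear hK h'K.
pose hl := GRing.isLinear.Build _ _ _ _ h' h'lin.
pose H' : {linear _ -> _} := HB.pack h' hl.
exists J, tag, (fun j v => h v j), (fun j m => h' (@dsum_inj J MM j m)).
split.
- move=> j; split=> [v w|r v].
    have hD : h (v + w) = h v + h w := raddfD h v w.
    by rewrite hD ffunE.
  have hZ : h (r ^+ (p ^ e) * v) = r *: h v := linearZ_LR h r v.
  by rewrite hZ ffunE.
- move=> j; split=> [v w|r v].
    by rewrite dsum_injD; apply: (raddfD H').
  by rewrite dsum_injZ; apply: (linearZ_LR H').
move=> v; rewrite -[LHS]hK {1}[h v]dsum_injE.
exact: (raddf_sum H').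
Qed.

End Retracts.

Lemma pigeonhole_infinite s (P : nat -> 'I_s -> Prop) :
  (forall e, exists i, P e i) ->
  exists i, forall b, exists2 e, (b <= e)%N & P e i.
Proof.
move=> exP; apply: contrapT => noi.
have /choice[b bP] : forall i, exists b, forall e, (b <= e)%N -> ~ P e i.
  move=> i; apply: contrapT => nob; apply: noi; exists i => b.
  by apply: contrapT => noe; apply: nob; exists b => e le_be Pei; apply: noe; exists e.
have [i Pi] := exP (\max_(i < s) b i)%N.
exact: (bP i _ (leq_bigmax i) Pi).
Qed.

Lemma infinite_injection (P : nat -> Prop) :
  (forall b, exists2 e, (b <= e)%N & P e) ->
  exists f : nat -> nat, {homo f : i j / (i < j)%N} /\ forall i, P (f i).
Proof.
move=> exP; have /choice[g gP] : forall b, exists e, (b <= e)%N /\ P e.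
  by move=> b; have [e le_be Pe] := exP b; exists e.
pose f := fix f i := if i is j.+1 then g (f j).+1 else g 0%N.
exists f; split; last by case=> [|i]; [have [] := gP 0%N | have [] := gP (f i).+1].
apply: homo_ltn => [i j k|i]; first exact: ltn_trans.
by have [] := gP (f i).+1.
Qed.

Section NotFFRT.
Variables (F : fieldType) (L : fieldExtType F) (t : L) (R : comNzRingType).
Variables (cst : {rmorphism F -> R}) (x y : R) (co : nat -> R -> L).
Hypothesis coE : expansion t cst x y co.
Hypothesis span_t : forall z : L, exists a : 'I_4 -> F, z = \sum_i a i *: t ^+ i.
Variables (p : nat) (charRp : p \in [pchar R]).
Variable root_t : nat -> L.
Hypothesis root_tK : forall e, root_t e ^+ (p ^ e) = t.
(* t^(p^e' / p^e) is not a Moebius transform of t over F. *)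
Hypothesis not_moebius : forall e e' (a b c d : F), e <> e' ->
  root_t e ^+ (p ^ e') * (a%:A + b *: t) = c%:A + d *: t ->
  a%:A + b *: t = 0.

HB.instance Definition _ n := GRing.isZmodMorphism.Build R L (co n) (coB coE n).

(** In eR the elements x and y satisfy P^(p^e) y = y^(3 p^e) x, where P is the cubic
    form with P(t, 1) = root_t e; a map from eR to e'R turns this into a relation
    between the images of x and y with exponent p^e'. *)
Lemma cross_coef1 e e' (M : lmodType R) (f : R -> M) (g : M -> R) :
  e <> e' -> frob_linear p e f -> linear_frob p e' g -> co 1 (g (f y)) = 0.
Proof.
move=> neq_e [_ fZ] [_ gZ].
have [P PE] := homog_exists coE span_t (root_t e) (leqnn 3).
have relR : P ^+ (p ^ e) * y = y ^+ 3 ^+ (p ^ e) * x.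
  have hP := homogM coE (homogX coE (p ^ e) PE) (homog_y coE).
  have hy := homogM coE (homogX coE (p ^ e) (homogX coE 3 (homog_y coE))) (homog_x coE).
  rewrite root_tK mulr1 in hP; rewrite !expr1n mul1r mul1n in hy.
  exact: (homog_inj coE hP hy).
have relM : P ^+ (p ^ e') * g (f y) = y ^+ 3 ^+ (p ^ e') * g (f x).
  by rewrite -!gZ -!fZ relR.
have := congr1 (co (3 * p ^ e' + 1)) relM.
rewrite (homog_coM coE _ _ (homogX coE (p ^ e') PE)).
have hy := homogX coE (p ^ e') (homogX coE 3 (homog_y coE)).
rewrite !expr1n mul1n in hy; rewrite (homog_coM coE _ _ hy) mul1r.
have [a [b ->]] := co_deg1 coE (g (f y)).
by have [c [d ->]] := co_deg1 coE (g (f x)); apply: not_moebius.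
Qed.

Lemma expansion_not_FFRT : ~ finite_F_rep_type charRp.
Proof.
move=> /finite_F_rep_retracts[s [M [fgM retM]]].
pose good e (i : 'I_s) := (0 < e)%N -> exists (f : R -> M i) (g : M i -> R),
  [/\ frob_linear p e f, linear_frob p e g & co 1 (g (f y)) != 0].
(* A module M i0 through which the coefficient of degree 1 of y survives, for
   infinitely many e. *)
have [i0 /infinite_injection[es [es_mono]]] : exists i, forall b,
    exists2 e, (b <= e)%N & good e i.
  apply: pigeonhole_infinite => e.
  have [J [tau [f [g [flin glin fgE]]]]] := retM e.
  have [j j1] : exists j, co 1 (g j (f j y)) != 0.
    apply: contrapT => no_j; have := congr1 (co 1) (fgE y).
    rewrite (co_y coE) eqxx raddf_sum big1 => [/eqP|j _]; first by rewrite oner_eq0.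
    by apply/eqP/contraT => j1; case: no_j; exists j.
  by exists (tau j) => _; exists (f j), (g j).
move=> good_es; have [n [gen genM]] := fgM i0.
(* The shift by one makes all these exponents positive. *)
pose ex (j : nat) := es j.+1.
have ex_gt0 j : (0 < ex j)%N by apply: leq_ltn_trans (es_mono 0%N j.+1 _).
have ex_inj j j' : j <> j' -> ex j <> ex j'.
  move=> neq_j; have /orP[lt|lt] : (j < j')%N || (j' < j)%N by lia.
    by have := es_mono j.+1 j'.+1 lt; rewrite /ex; lia.
  by have := es_mono j'.+1 j.+1 lt; rewrite /ex; lia.
have /choice[f /choice[g fgP]] : forall j, exists (f : R -> M i0) (g : M i0 -> R),
    [/\ frob_linear p (ex j) f, linear_frob p (ex j) g & co 1 (g (f y)) != 0].
  by move=> j; apply: good_es (ex_gt0 j).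
have /choice[r rE] : forall j, exists r : 'I_n -> R, f j y = \sum_l r l *: gen l.
  by move=> j; apply: genM.
have /choice[eps epsE] : forall v, exists a, co 0 v = a%:A.
  exact: (co_deg0 coE).
have [c [[j cj0] cE]] :=
  mx_dependence (\matrix_(j < n.+1, l < n) eps (r j l)) (ltnSn n).
case/eqP: cj0; have [[fD fZ] [gD gZ] gf1] := fgP j.
have g0 : g j 0 = 0.
  by have := gZ 0 0; rewrite scale0r expr0n expn_eq0 -leqn0 leqNgt
    (prime_gt0 (pcharf_prime charRp)) mul0r.
have gsum (I : finType) (w : I -> M i0) : g j (\sum_i w i) = \sum_i g j (w i).
  by elim/big_rec2: _ => // i v w' _ <-; rewrite gD.
(* By the choice of c, w lies in the maximal ideal times M i0, while g j only sees
   its j-th term. *)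
pose w := \sum_(j' < n.+1) cst (c j') *: f j' y.
have wl : co 1 (g j w) = c j ^+ (p ^ ex j) *: co 1 (g j (f j y)).
  rewrite gsum raddf_sum (bigD1 j) //= big1 ?addr0 => [|j' neq_j].
    by rewrite gZ -rmorphXn (co_cstM coE).
  rewrite gZ -rmorphXn (co_cstM coE).
  rewrite (@cross_coef1 (ex j') (ex j) (M i0) (f j') (g j)) ?scaler0 //.
  + by apply: ex_inj => /val_inj /eqP; apply/negP.
  + by have [] := fgP j'.
have wE : w = \sum_(l < n) (\sum_(j' < n.+1) cst (c j') * r j' l) *: gen l.
  rewrite /w; under eq_bigr do rewrite rE scaler_sumr.
  rewrite exchange_big; apply: eq_bigr => l _; rewrite scaler_suml.
  by apply: eq_bigr => j' _; rewrite scalerA.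
(* An element m of the maximal ideal acts on e'R by m^(p^e'), which has order at
   least 2. *)
have wr : co 1 (g j w) = 0.
  rewrite wE gsum raddf_sum big1 //= => l _; rewrite gZ.
  set m := \sum_(j' < _) _.
  have m0 : co 0 m = 0.
    rewrite raddf_sum /=; under eq_bigr do rewrite (co_cstM coE) epsE scalerA.
    rewrite -scaler_suml; have := cE l.
    by under eq_bigr do rewrite mxE; move=> ->; rewrite scale0r.
  have : (1 < p ^ ex j)%N.
    by rewrite -(exp1n (ex j)) ltn_exp2r // prime_gt1 // (pcharf_prime charRp).
  case: (p ^ ex j)%N => [|[|q]] // _; rewrite !exprS -mulrA.
  apply: (co_low coE (a := 1) (b := 1)) => // [[]//|[]// _].
  by rewrite (co0M coE) (co0M coE) m0 !mul0r.
move/eqP: wl; rewrite wr eq_sym scaler_eq0 (negPf gf1) orbF expf_eq0.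
by case/andP => _ /eqP.
Qed.

End NotFFRT.

(** * Division in the graded ring and in its completion *)

Lemma strong_recursion (T : Type) (x0 : T) (G : nat -> (nat -> T) -> T) :
  (forall n f g, (forall i, (i < n)%N -> f i = g i) -> G n f = G n g) ->
  exists f, forall n, f n = G n f.
Proof.
move=> G_ext.
pose fs := fix fs n := if n is m.+1 then rcons (fs m) (G m (nth x0 (fs m))) else [::].
have size_fs n : size (fs n) = n by elim: n => //= n IHn; rewrite size_rcons IHn.
pose f n := nth x0 (fs n.+1) n.
have fsE n i : (i < n)%N -> nth x0 (fs n) i = f i.
  elim: n => // n IHn; rewrite ltnS leq_eqVlt => /orP[/eqP -> //|lt_in] /=.
  by rewrite nth_rcons size_fs lt_in IHn.
exists f => n; rewrite {1}/f /= nth_rcons size_fs ltnn eqxx.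
by apply: G_ext => i; apply: fsE.
Qed.

Section FiniteExpansion.
Variables (F : fieldType) (L : fieldExtType F) (t : L) (R : comNzRingType).
Variables (cst : {rmorphism F -> R}) (x y : R) (co : nat -> R -> L).
Hypothesis coE : expansion t cst x y co.
Hypothesis span_t : forall z : L, exists a : 'I_4 -> F, z = \sum_i a i *: t ^+ i.
Hypothesis co_finite : forall r, exists d, forall n, (d <= n)%N -> co n r = 0.

HB.instance Definition _ n := GRing.isZmodMorphism.Build R L (co n) (coB coE n).

(** The leading form of r is divisible by that of a once the degrees differ by at
    least 3, because every homogeneous quotient of degree >= 3 is available. *)
Lemma finite_reduction (a : R) d : co d a != 0 ->
  (forall n, (d < n)%N -> co n a = 0) ->
  forall r, exists z, forall n, (d + 3 <= n)%N -> co n (r - a * z) = 0.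
Proof.
move=> ad a_gt r; have [D] := co_finite r.
elim: D r => [|D IHD] r r_gt; first by exists 0 => n _; rewrite mulr0 subr0 r_gt.
have [le_d3D|lt_Dd3] := leqP (d + 3) D; last first.
  by exists 0 => n le_n; rewrite mulr0 subr0 r_gt // (leq_trans lt_Dd3).
have le_dD : (d <= D)%N by lia.
have [h hE] : exists h, homog_at co (D - d)%N (co D r / co d a) h.
  by apply: (homog_exists coE span_t); lia.
have [n le_Dn|z zE] := IHD (r - h * a); last first.
  by exists (h + z) => n /zE <-; congr (co n _); ring.
rewrite raddfB /=; have -> : n = (D - d + (n - (D - d)))%N by lia.
rewrite (homog_coM coE _ _ hE).
have [eq_Dn|lt_Dn] : n = D \/ (D < n)%N by lia.
  have -> : (n - (D - d) = d)%N by lia.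
  by rewrite divfK // subnK // subrr.
by rewrite r_gt ?(a_gt (n - (D - d))%N) ?mulr0 ?subr0 //; lia.
Qed.

(** Reduced modulo a, elements have degree less than d + 3, hence bounded
    dimension. *)
Lemma finite_expansion_codim (a : R) : a != 0 -> finite_codim cst a.
Proof.
move=> a0; have [n0 an0 _] := co_ord coE a0.
have exd : exists n, co n a != 0 by exists n0.
have [D aD] := co_finite a.
have [n|d ad max_d] := @ex_maxnP (fun n => co n a != 0) D exd.
  by rewrite leqNgt; apply: contra => /ltnW/aD ->.
have a_gt n : (d < n)%N -> co n a = 0.
  by move=> lt_dn; apply/eqP/contraT => /max_d; rewrite leqNgt lt_dn.
exists (4 * (d + 3)).+1%N => r.
have /choice[z zE] : forall i, exists z, forall n, (d + 3 <= n)%N -> co n (r i - a * z) = 0.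
  by move=> i; apply: finite_reduction.
have [c [c0 cE]] := low_dependence coE span_t (fun i => r i - a * z i).
exists c; split=> //; exists (\sum_i cst (c i) * z i).
apply/eqP; rewrite -subr_eq0 mulr_sumr -sumrB; apply/eqP/(co_inj coE) => n.
have -> : \sum_i (cst (c i) * r i - a * (cst (c i) * z i)) =
    \sum_i cst (c i) * (r i - a * z i).
  by apply: eq_bigr => i _; ring.
have [/cE //|le_n] := ltnP n (d + 3).
by rewrite raddf_sum big1 //= => i _; rewrite (co_cstM coE) zE // scaler0.
Qed.

End FiniteExpansion.

Section FullExpansion.
Variables (F : fieldType) (L : fieldExtType F) (t : L) (R : comNzRingType).
Variables (cst : {rmorphism F -> R}) (x y : R) (co : nat -> R -> L).
Hypothesis coE : expansion t cst x y co.
Hypothesis span_t : forall z : L, exists a : 'I_4 -> F, z = \sum_i a i *: t ^+ i.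
(* Every series of order at least 3 belongs to R. *)
Hypothesis co_full : forall s : nat -> L, (forall i, (i < 3)%N -> s i = 0) ->
  exists r, forall n, co n r = s n.

HB.instance Definition _ n := GRing.isZmodMorphism.Build R L (co n) (coB coE n).

(** Division of power series, coefficient by coefficient; the quotient has order at
    least 3 and therefore belongs to R. *)
Lemma full_divides (a r : R) d : co d a != 0 ->
    (forall i, (i < d)%N -> co i a = 0) ->
    (forall i, (i < d + 3)%N -> co i r = 0) ->
  exists z, r = z * a.
Proof.
move=> ad a_lt r_lt.
pose G n (f : nat -> L) :=
  (co (n + d) r - \sum_(i < n) f i * co (n + d - i)%N a) / co d a.
have [n f g fg|s sE] := strong_recursion 0 (G := G).
  by rewrite /G; congr ((_ - _) / _); apply: eq_bigr => i _; rewrite fg.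
have [i lt_i3|z zE] := co_full (s := s).
  elim/ltn_ind: i lt_i3 => i IHi lt_i3.
  rewrite sE /G r_lt ?big1 ?subr0 ?mul0r // => [j _|].
    by rewrite IHi ?mul0r // (ltn_trans _ lt_i3).
  by lia.
exists z; apply/eqP; rewrite -subr_eq0; apply/eqP/(co_inj coE) => n.
rewrite raddfB /=; apply/eqP; rewrite subr_eq0; apply/eqP.
have [lt_nd|le_dn] := ltnP n d.
  rewrite (co_low coE (a := 0) (b := d)) // r_lt //; lia.
rewrite -(subnK le_dn); move: (n - d)%N => m.
rewrite (coM coE); have le_m : (m.+1 <= (m + d).+1)%N by lia.
rewrite (bigID (fun i : 'I__ => i < m.+1)%N) /= [X in _ + X]big1 ?addr0; last first.
  by move=> i le_mi; rewrite a_lt ?mulr0 //; have := ltn_ord i; lia.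
rewrite (big_ord_narrow le_m) big_ord_recr /= addKn.
apply/eqP; rewrite addrC -subr_eq zE; apply/eqP.
by rewrite {1}sE /G divfK //; congr (_ - _); apply: eq_bigr => i _; rewrite zE.
Qed.

Lemma full_expansion_codim (a : R) : a != 0 -> finite_codim cst a.
Proof.
move=> /(co_ord coE)[d ad a_lt]; exists (4 * (d + 3)).+1%N => r.
have [c [c0 cE]] := low_dependence coE span_t r.
exists c; split=> //; have [z ->] := full_divides ad a_lt cE.
by exists z; rewrite mulrC.
Qed.

Let m := irrelevant_ideal co.

(** Up to a scalar a = 1 - w with w of positive order; w^3 has order at least 3, so
    it is divisible by 1 - w^3, which makes 1 - w^3 = (1 - w) (1 + w + w^2) a unit. *)
Lemma full_unit (a : R) : a \notin m -> exists b, b * a = 1.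
Proof.
rewrite inE => a0; have [al aE] := co_deg0 coE a.
have al0 : al != 0 by apply: contraNneq a0 => al0; rewrite aE al0 scale0r.
pose w := 1 - cst al^-1 * a.
have w0 : co 0 w = 0.
  rewrite raddfB /= (co_cstM coE) aE scalerA mulVf // -(rmorph1 cst) (co_cst coE).
  by rewrite subrr.
have w3 n : (n < 3)%N -> co n (w ^+ 3) = 0.
  have low1 i : (i < 1)%N -> co i w = 0 by case: i.
  apply: (co_low coE (a := 1) (b := 2)) => // i.
  by apply: (co_low coE (a := 1) (b := 1)).
have v0 : co 0 (1 - w ^+ 3) != 0.
  by rewrite raddfB /= w3 // subr0 -(rmorph1 cst) (co_cst coE) scaler_eq0 !oner_eq0.
have [//|z zE] := full_divides (r := w ^+ 3) v0 _ w3.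
exists ((1 + z) * (1 + w + w ^+ 2) * cst al^-1).
have E : (1 + z) * (1 - w ^+ 3) = 1 by rewrite mulrDl -zE mul1r subrK.
rewrite -[RHS]E -mulrA; have -> : cst al^-1 * a = 1 - w by rewrite /w; ring.
by ring.
Qed.

Lemma proper_sub_irrelevant (J : {pred R}) : idealr_closed J -> {subset J <= m}.
Proof.
move=> [J0 J1 JD] a Ja; apply: contraT => /full_unit[b ba].
by case/negP: J1; rewrite -ba; have := JD b a 0 Ja J0; rewrite addr0.
Qed.

Lemma ideal_pow_order n a : in_ideal_pow m n a -> forall i, (i < n)%N -> co i a = 0.
Proof.
move=> [r [c [b [mb ->]]]] i lt_in; rewrite raddf_sum big1 //= => j _.
apply: (co_low coE (a := 0) (b := n)) => // {lt_in}.
elim: n b mb => // n IHn b mb k; rewrite big_ord_recl.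
apply: (co_low coE (a := 1) (b := n)) => [[]// _|k'].
  by have := mb j ord0; rewrite inE => /eqP.
exact: (IHn (fun j l => b j (lift ord0 l))).
Qed.

(** The loss of 3 degrees comes from dividing by y^n inside R. The powers of the
    maximal ideal and the filtration by the order still define the same topology. *)
Lemma order_ideal_pow n a : (forall i, (i < n + 3)%N -> co i a = 0) -> in_ideal_pow m n a.
Proof.
move=> a_lt; have yn := homogX coE n (homog_y coE); rewrite mul1n expr1n in yn.
have [|||z ->] := full_divides (a := y ^+ n) (r := a) (d := n);
  rewrite ?yn ?eqxx ?oner_eq0 //.
  by move=> i lt_in; rewrite yn ltn_eqF.
exists 1%N, (fun=> z), (fun _ _ => y); split=> [_ _|]; first exact: irrelevant_y coE.
by rewrite big_ord1 prodr_const card_ord.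
Qed.

Lemma full_adic_complete : adic_complete m.
Proof.
split=> [a am|s /choice[N NE]].
  by apply: (co_inj coE) => n; apply: ideal_pow_order (am n.+1) _ _.
have sE n i j : (N n.+1 <= i)%N -> (N n.+1 <= j)%N -> co n (s i) = co n (s j).
  move=> Ni Nj; apply/eqP; rewrite -subr_eq0 -raddfB; apply/eqP.
  exact: ideal_pow_order (NE _ _ _ Ni Nj) _ _.
pose T n := co n (s (N n.+1)).
have [i lt_i3|z zE] := co_full (s := fun n => T n - co n (s (N 3))).
  apply/eqP; rewrite subr_eq0 /T; apply/eqP.
  rewrite (sE i _ (maxn (N i.+1) (N 3))) ?leq_maxl //.
  apply/eqP; rewrite -subr_eq0 -raddfB; apply/eqP.
  by apply: (ideal_pow_order (NE 3 _ _ _ _)); rewrite ?leq_maxr.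
have lE n : co n (s (N 3) + z) = T n by rewrite raddfD /= zE addrC subrK.
exists (s (N 3) + z) => n; exists (\max_(j < n + 3) N j.+1)%N => i le_i.
apply: order_ideal_pow => j lt_j; rewrite raddfB /= lE; apply/eqP; rewrite subr_eq0.
apply/eqP/sE => //; apply: leq_trans le_i.
exact: (leq_bigmax (F := fun j : 'I_(n + 3) => N j.+1) (Ordinal lt_j)).
Qed.

Lemma full_complete_local : complete_local R.
Proof.
split; first exact: finite_codim_noetherian full_expansion_codim.
have [idm _] := irrelevant_prime coE.
exists m; split; last exact: full_adic_complete.
  split=> // J idJ mJ a; apply/idP/idP; [exact: proper_sub_irrelevant | exact: mJ].
move=> J [idJ maxJ] a; rewrite (maxJ m) //; exact: proper_sub_irrelevant.
Qed.

End FullExpansion.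

(** * The quartic over the perfect closure of F_2(u) *)

Lemma F2u_fraction (a : F2u) :
  exists (P Q : {poly 'F_2}), Q != 0 /\ a * Q%:F = P%:F.
Proof.
elim/quotW: a => r; exists (\n_r), (\d_r); split; first exact: denom_ratioP.
rewrite -[LHS]/(FracField.mul _ _) !piE; apply/eqP.
rewrite FracField.equivf_def /FracField.mulf.
by rewrite !numden_Ratio ?mulr1 ?oner_neq0 ?denom_ratioP // mulrC.
Qed.

(** At u = 0 the form is (X^2 + X Y + Y^2)^2, without nontrivial zero over F_2; so u
    divides both arguments of a zero, and infinite descent applies. *)
Lemma quartic_X_eq0 m (P Q : {poly 'F_2}) :
  (0 < m)%N -> quartic 'X^m P Q = 0 -> Q = 0.
Proof.
move=> m0; elim: {Q}(size Q) {-2}Q P (leqnn (size Q)) => [|n IHn] Q P.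
  by rewrite leqn0 size_poly_eq0 => /eqP.
move=> leQ PQ0.
have [P0 Q0] : P.[0] = 0 /\ Q.[0] = 0.
  have := congr1 (horner^~ 0) PQ0; rewrite /quartic !hornerE (expr0n _ m) (gtn_eqF m0) /=.
  move: (P.[0]) (Q.[0]).
  by do 2![case=> [[|[|//]] ?]] => /eqP //; split; apply/val_inj.
have /factor_theorem[P' PE] : root P 0 by apply/rootP.
have /factor_theorem[Q' QE] : root Q 0 by apply/rootP.
rewrite !subr0 in PE QE; have [Q'0|Qn0] := eqVneq Q' 0.
  by rewrite QE Q'0 mul0r.
rewrite QE (IHn Q' P') ?mul0r //.
  by move: leQ; rewrite QE size_mulX.
apply: (mulIf (x := 'X^4)); first by rewrite expf_neq0 ?polyX_eq0.
by rewrite mul0r -PQ0 PE QE /quartic; ring.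
Qed.

Lemma F2u_quartic_neq0 m (a : F2u) : (0 < m)%N -> quartic ('X^m)%:F a 1 != 0.
Proof.
move=> m0; have [P [Q [Q0 aQ]]] := F2u_fraction a.
apply: contra_neq Q0 => qa0; apply: (quartic_X_eq0 (P := P) m0).
apply/eqP; rewrite -tofrac_eq0 (rmorph_quartic (@FracField.tofrac _)) /= -aQ.
suff -> : quartic ('X^m)%:F (a * Q%:F) Q%:F = quartic ('X^m)%:F a 1 * Q%:F ^+ 4.
  by rewrite qa0 mul0r.
by rewrite /quartic; ring.
Qed.

(** For a = P / Q, the equation P^3 + P Q^2 = u^(2^e) Q^3 forces deg P > deg Q, and
    then 3 deg P = 2^e + 3 deg Q. *)
Lemma F2u_cubic_neq e (a : F2u) : a ^+ 3 + a != ('X^(2 ^ e))%:F.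
Proof.
have [P [Q [Q0 aQ]]] := F2u_fraction a.
apply/eqP => a3; have {a3 aQ} PQ : P ^+ 3 + P * Q ^+ 2 = 'X^(2 ^ e) * Q ^+ 3.
  apply/eqP; rewrite -tofrac_eq; rewrite !(rmorphD, rmorphM, rmorphXn) /= -aQ.
  by rewrite -rmorphXn /= -a3; apply/eqP; ring.
have P0 : P != 0.
  apply: contraNneq Q0 => P0; move/esym/eqP: PQ.
  by rewrite P0 expr0n mul0r addr0 mulf_eq0 !expf_eq0 polyX_eq0 !andbF.
have sE (S : {poly 'F_2}) n : S != 0 -> size (S ^+ n) = ((size S).-1 * n).+1%N.
  by move=> S0; rewrite -size_exp prednK // lt0n size_poly_eq0 expf_neq0.
have sX n : size ('X^(2 ^ e) * Q ^+ n) = (2 ^ e + (size Q).-1 * n).+1%N.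
  by rewrite mulrC size_mulXn ?expf_neq0 // sE // addnS.
have sP3 : size (P ^+ 3) = ((size P).-1 * 3).+1%N by rewrite sE.
have sPQ : size (P * Q ^+ 2) = ((size P).-1 + (size Q).-1 * 2).+1%N.
  by rewrite size_mul ?expf_neq0 // sE // (polySpred P0) addSn addnS.
have e2 : (0 < 2 ^ e)%N by rewrite expn_gt0.
have [lt_QP|le_PQ] := ltnP (size Q).-1 (size P).-1.
  have : size (P ^+ 3 + P * Q ^+ 2) = size (P ^+ 3).
    by rewrite size_polyDl // sP3 sPQ; lia.
  rewrite PQ sX sP3 => -[]. 
  have : ~~ (3 %| 2 ^ e)%N by rewrite Euclid_dvdX //= negb_and.
  move=> /negP n3 h; apply: n3; apply/dvdnP.
  by exists ((size P).-1 - (size Q).-1)%N; rewrite mulnBl -h addnK.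
have := size_polyD (P ^+ 3) (P * Q ^+ 2).
by rewrite PQ sX sP3 sPQ; lia.
Qed.

Lemma uperf_root e : uperf = perf_root F2u_pchar e ('X^(2 ^ e))%:F.
Proof. by rewrite -(urootK e) /uroot -rmorphXn /= -rmorphXn. Qed.

Lemma uroot_neq0 e : uroot e != 0.
Proof. by rewrite fmorph_eq0 tofrac_eq0 polyX_eq0. Qed.

(** A power z^(2^e) is a root of the quartic whose parameter is a power of u; this
    brings the question back to F_2(u). *)
Lemma kperf_quartic_neq0 e e' (z : kperf) : quartic (uroot e ^+ (2 ^ e')) z 1 != 0.
Proof.
apply/negP => /eqP qz0; have [f [a zE]] := perf_rootP (z ^+ (2 ^ e)).
have pow_gt0 : (0 < 2 ^ f * 2 ^ e')%N by rewrite muln_gt0 !expn_gt0.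
apply/negP: (F2u_quartic_neq0 a pow_gt0); rewrite negbK.
rewrite -(fmorph_eq0 (perf_root F2u_pchar f)) (rmorph_quartic (perf_root F2u_pchar f)) /= -zE.
rewrite exprM rmorphXn rmorphXn /= -uperf_root -(urootK e) rmorph1.
have := congr1 (fun v => v ^+ (2 ^ e)) qz0.
rewrite /quartic !(powD kperf_pchar) !exprMn !expr1n expr0n expn_eq0 /= => q0.
apply/eqP; rewrite -[RHS]q0 [uroot e ^+ _ ^+ _]exprAC.
by move: (z ^+ _) (uroot e ^+ _ ^+ _) => v w; ring.
Qed.

Lemma kperf_cubic_neq (z : kperf) : z ^+ 3 + z != uperf.
Proof.
have [e [a ->]] := perf_rootP z.
by rewrite (uperf_root e) -rmorphXn -rmorphD (inj_eq (fmorph_inj _)) F2u_cubic_neq.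
Qed.

Lemma uroot_pow_inj e e' : uroot e ^+ (2 ^ e') = uperf -> e = e'.
Proof.
rewrite (uperf_root e) /uroot -rmorphXn => /fmorph_inj; rewrite -rmorphXn.
move=> /eqP; rewrite tofrac_eq => /eqP.
move/(congr1 (fun p : {poly 'F_2} => size p)); rewrite !size_polyXn => -[/eqP].
by rewrite eqn_exp2l // => /eqP.
Qed.

Lemma kperf_sqrt (z : kperf) : exists w, w ^+ 2 = z.
Proof.
have [e [a ->]] := perf_rootP z; exists (perf_root F2u_pchar e.+1 a).
rewrite -rmorphXn /perf_root; apply/eqP/perf_eqP => /=.
by rewrite -exprM expnS.
Qed.

Section QuarticField.
Variables (F : fieldType) (c : F).
Hypothesis charF2 : 2%N \in [pchar F].

Definition quart_poly : {poly F} := quartic c%:P 'X 1.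

Lemma quart_polyE : quart_poly = Poly [:: 1; c; 1; 0; 1].
Proof. by rewrite /quart_poly /quartic /= !cons_poly_def; ring. Qed.

Lemma coef_quart_poly i : quart_poly`_i = [:: 1; c; 1; 0; 1]`_i.
Proof. by rewrite quart_polyE coef_Poly. Qed.

Lemma size_quart_poly : size quart_poly = 5.
Proof. by rewrite quart_polyE (PolyK (c := 0)) //= oner_neq0. Qed.

Lemma horner_quart_poly (S : comNzRingType) (f : {rmorphism F -> S}) (v : S) :
  (map_poly f quart_poly).[v] = quartic (f c) v 1.
Proof.
rewrite /quart_poly (rmorph_quartic (map_poly f)) rmorph1 /= map_polyX map_polyC.
by rewrite /quartic !hornerE.
Qed.

Hypothesis noroot : forall v : F, quartic c v 1 != 0.
Hypothesis nocubic : forall v : F, v ^+ 3 + v != c.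

(** A factor of degree 1 has a root. For a product of two quadratics, comparison of
    coefficients makes the quotient of the two upper coefficients of a factor a root
    of the resolvent v^3 + v = c. *)
Lemma quart_poly_irreducible : irreducible_poly quart_poly.
Proof.
split=> [|q q1 /dvdpP[r PE]]; first by rewrite size_quart_poly.
have P0 : quart_poly != 0 by rewrite -size_poly_eq0 size_quart_poly.
have [r0 q0] : r != 0 /\ q != 0 by apply/andP; rewrite -negb_or -mulf_eq0 -PE.
have nrt (v : F) : ~~ root quart_poly v.
  apply: contra (noroot v) => /rootP; have := horner_quart_poly idfun v.
  by rewrite map_poly_id // => -> ->.
have sz : (size r + size q = 6)%N.
  have := size_mul r0 q0; rewrite -PE size_quart_poly.
  by rewrite (polySpred r0) addSn => /= <-.
have root2 (s : {poly F}) : size s = 2%N -> s %| quart_poly -> False.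
  move=> s2 sP; have [v sv] := poly2_root s2.
  by have := nrt v; rewrite (root_dvdp sP).
have rP : r %| quart_poly by rewrite PE dvdp_mulr.
have qP : q %| quart_poly by rewrite PE dvdp_mull.
have sr : (0 < size r)%N by rewrite size_poly_gt0.
have sq : (0 < size q)%N by rewrite size_poly_gt0.
have [/root2/(_ qP)//|s2] := eqVneq (size q) 2%N.
have [/root2/(_ rP)//|sr2] := eqVneq (size r) 2%N.
have [s3|s3] := eqVneq (size q) 3%N; last first.
  by rewrite -(dvdp_size_eqp qP) size_quart_poly; apply/eqP; lia.
have r3 : size r = 3%N by lia.
have rc3 i : (2 < i)%N -> r`_i = 0 by move=> ?; rewrite nth_default ?r3.
have qc3 i : (2 < i)%N -> q`_i = 0 by move=> ?; rewrite nth_default ?s3.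
have cf i := congr1 (fun p : {poly F} => p`_i) PE.
have := cf 4; have := cf 3; have := cf 2; have := cf 1.
rewrite !coef_quart_poly !coefM !big_ord_recl !big_ord0 /= /bump /= !addn0 ?subn0.
rewrite /subn /= !(rc3 3) // !(rc3 4) // !(qc3 3) // !(qc3 4) // !(mulr0, mul0r, addr0, add0r).
move: (r`_0) (r`_1) (r`_2) (q`_0) (q`_1) (q`_2) => a0 a1 a2 b0 b1 b2 e1 e2 e3 e4.
have /eqP[] := nocubic (b1 * a2).
have e3' : a1 * b2 = b1 * a2.
  by apply/eqP; rewrite -subr_eq0 (oppr_pchar2 charF2) [b1 * _]mulrC; apply/eqP.
have -> : (b1 * a2) ^+ 3 + b1 * a2 = b1 * a2 * ((a1 * b2) * (b1 * a2) + 1).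
  by rewrite e3'; ring.
have -> : a1 * b2 * (b1 * a2) + 1 = a0 * b2 + a2 * b0.
  have -> : a1 * b2 * (b1 * a2) = a1 * b1 * (a2 * b2) by ring.
  rewrite -e4 mulr1 {1}e2 addrCA [in X in _ + X]addrA.
  by rewrite (addrr_pchar2 charF2) add0r.
rewrite mulrDr {2}(esym e3') e1; congr (_ + _); rewrite -[RHS]mulr1 e4; ring.
Qed.

(** The second property says that the quartic is the minimal polynomial of t. *)
Lemma quartic_extension : exists (L : fieldExtType F) (t : L),
  (forall z : L, exists a : 'I_4 -> F, z = \sum_i a i *: t ^+ i) /\
  forall q : {poly F}, (map_poly (in_alg L) q).[t] = 0 <-> quart_poly %| q.
Proof.
have irrP := quart_poly_irreducible.
have [L _ [t tP tL]] := irredp_FAdjoin irrP; exists L, t.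
have P0 : quart_poly != 0 by rewrite -size_poly_eq0 size_quart_poly.
have dvdE q : (map_poly (in_alg L) q).[t] = 0 <-> quart_poly %| q.
  split=> [qt0|/dvdpP[r ->]]; last first.
    by rewrite rmorphM /= hornerM (rootP tP) mulr0.
  apply: contraT => ndvd; have cop : coprimep quart_poly q.
    apply/coprimepP => d dP dq; rewrite -size_poly_eq1; apply: contraT => d1.
    have [_ /(_ d d1 dP) dE] := irrP.
    by case/negP: ndvd; rewrite -(eqp_dvdl _ dE).
  have := @coprimep_root L (map_poly (in_alg L) quart_poly) (map_poly (in_alg L) q) t.
  by rewrite coprimep_map => /(_ cop tP) /eqP.
split=> // z.
have /Fadjoin_polyP[q' /polyOver1P[q ->] ->] : z \in <<1; t>>%VS by rewrite tL memvf.
pose r := q %% quart_poly.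
have sr : (size r < size quart_poly)%N by rewrite ltn_modp.
rewrite size_quart_poly ltnS in sr.
exists (fun i => r`_i).
have -> : (map_poly (in_alg L) q).[t] = (map_poly (in_alg L) r).[t].
  rewrite {1}(divp_eq q quart_poly) rmorphD rmorphM /= !hornerE.
  by rewrite (rootP tP) mulr0 add0r.
rewrite (@horner_coef_wide _ 4) ?size_map_poly //.
by apply: eq_bigr => i _; rewrite coef_map /= mulr_algl.
Qed.

End QuarticField.

(** The substitution X |-> (c + d X) / (a + b X) in the quartic of parameter W. The
    coefficients of X and X^3 are multiples of the determinant c b + a d. *)
Lemma quartic_linear (F : fieldType) (charF2 : 2%N \in [pchar F]) (W a b c d : F) :
  quartic W%:P (c%:P + d%:P * 'X) (a%:P + b%:P * 'X) =
  Poly [:: quartic W c a; W * (c * b + a * d) * a ^+ 2;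
    c ^+ 2 * b ^+ 2 + a ^+ 2 * d ^+ 2 + W * (c * b + a * d) * a * b;
    W * (c * b + a * d) * b ^+ 2; quartic W d b].
Proof.
have two : 2%:R = 0 :> {poly F} by apply: pcharf0; apply: (rmorph_pchar polyC) charF2.
rewrite /= !cons_poly_def /quartic.
rewrite !(rmorphD, rmorphM, rmorphXn) /= ?polyC0.
move: (a%:P) (b%:P) (c%:P) (d%:P) (W%:P) => a' b' c' d' W'.
(* E1, ..., E4 are the halves of the mixed terms of the four summands of the
   quartic, which vanish in characteristic 2. *)
pose E1 := 2%:R * c' ^+ 3 * d' * 'X + 3%:R * c' ^+ 2 * d' ^+ 2 * 'X ^+ 2
  + 2%:R * c' * d' ^+ 3 * 'X ^+ 3.
pose E2 := c' * d' * 'X * (a' + b' * 'X) ^+ 2 + a' * b' * 'X * (c' ^+ 2 + d' ^+ 2 * 'X ^+ 2).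
pose E3 := W' * (c' + d' * 'X) * (a' + b' * 'X) * a' * b' * 'X.
pose E4 := 2%:R * a' ^+ 3 * b' * 'X + 3%:R * a' ^+ 2 * b' ^+ 2 * 'X ^+ 2
  + 2%:R * a' * b' ^+ 3 * 'X ^+ 3.
apply/eqP; rewrite -subr_eq0; apply/eqP.
transitivity (2%:R * (E1 + E2 + E3 + E4)); last by rewrite two mul0r.
by rewrite /E1 /E2 /E3 /E4; ring.
Qed.

Lemma quartic_pow (R : comNzRingType) (charR2 : 2%N \in [pchar R]) e (c x y : R) :
  quartic c x y ^+ (2 ^ e) = quartic (c ^+ (2 ^ e)) (x ^+ (2 ^ e)) (y ^+ (2 ^ e)).
Proof.
rewrite /quartic !(powD charR2) !exprMn.
by move: (c ^+ _) (x ^+ _) (y ^+ _) => c' x' y'; ring.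
Qed.

Section Roots.
Variables (L : fieldExtType kperf) (t : L).
Hypothesis span_t : forall z : L, exists a : 'I_4 -> kperf, z = \sum_i a i *: t ^+ i.
Hypothesis minpoly_t : forall q : {poly kperf},
  (map_poly (in_alg L) q).[t] = 0 <-> quart_poly uperf %| q.

Lemma L_pchar : 2%N \in [pchar L].
Proof. exact: (rmorph_pchar (in_alg L)) kperf_pchar. Qed.

Let algX (v : kperf) n : (v ^+ n)%:A = v%:A ^+ n :> L := rmorphXn (in_alg L) n v.

Lemma quartic_t : quartic uperf%:A t 1 = 0.
Proof.
rewrite -(horner_quart_poly uperf (in_alg L)).
by apply/minpoly_t.
Qed.

(** L is perfect because k is and because the quartic exhibits t as a square:
    u t = (t^2 + t + 1)^2. *)
Lemma L_sqrt (z : L) : exists w, w ^+ 2 = z.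
Proof.
have [a ->] := span_t z; have /choice[b bE] : forall i, exists b, b ^+ 2 = a i.
  by move=> i; apply: kperf_sqrt.
have [v vE] : exists v, v ^+ 2 = t.
  exists ((t ^+ 2 + t + 1) / (uroot 1)%:A); rewrite expr_div_n.
  have -> : (uroot 1)%:A ^+ 2 = uperf%:A :> L.
    by rewrite -(urootK 1) algX.
  have u0 : uperf%:A != 0 :> L by rewrite (fmorph_eq0 (in_alg L)) (uroot_neq0 0).
  apply: (mulIf u0); rewrite divfK //; apply/eqP.
  rewrite -subr_eq0 (oppr_pchar2 L_pchar) -quartic_t /quartic; apply/eqP.
  have two : 2%:R = 0 :> L := pcharf0 L_pchar.
  have -> : (t ^+ 2 + t + 1) ^+ 2 = t ^+ 4 + t ^+ 2 + 1 + 2%:R * (t ^+ 3 + t ^+ 2 + t) by ring.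
  by rewrite two; ring.
exists (\sum_i b i *: v ^+ i).
rewrite -(pFrobenius_autE L_pchar) rmorph_sum /=; apply: eq_bigr => i _.
by rewrite pFrobenius_autE exprZn bE -exprM mulnC exprM vE.
Qed.

Lemma L_root e : exists s, s ^+ (2 ^ e) = t.
Proof.
elim: e => [|e [s sE]]; first by exists t.
by have [w wE] := L_sqrt s; exists w; rewrite expnS exprM wE.
Qed.

(** The element z = s^(2^e') is a root of the quartic of parameter
    W = u^(2^e' / 2^e). If z is the quotient of c + d t by a + b t, the substituted
    quartic is a multiple of the minimal polynomial of t. Its coefficient of X^3
    gives b = 0 or a vanishing determinant; the determinant cannot vanish, as z is
    not in k. With b = 0, comparing X^2 with X^4 gives d = a, and comparing X with
    X^4 gives W = u, whence e = e'. *)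
Lemma not_moebius e e' (s : L) (a b c d : kperf) :
  s ^+ (2 ^ e) = t -> e <> e' ->
  s ^+ (2 ^ e') * (a%:A + b *: t) = c%:A + d *: t -> a%:A + b *: t = 0.
Proof.
move=> sE neq_e; set z := s ^+ _ => zN; apply/eqP/contraT => D0.
set W := uroot e ^+ (2 ^ e').
have qz : quartic W%:A z 1 = 0.
  suff qs : quartic (uroot e)%:A s 1 = 0.
    have := quartic_pow L_pchar e' (uroot e)%:A s 1.
    by rewrite qs (pow0 L_pchar) expr1n /W algX => <-.
  apply: (pow_inj L_pchar (e := e)); rewrite /= (quartic_pow L_pchar) (pow0 L_pchar).
  rewrite expr1n sE -quartic_t; congr (quartic _ _ _).
  by rewrite -(urootK e) algX.
have znF v : z <> v%:A.
  move=> zv; case/eqP: (kperf_quartic_neq0 e e' v); rewrite -/W.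
  apply: (fmorph_inj (in_alg L)).
  by rewrite (rmorph_quartic (in_alg L)) rmorph1 rmorph0 /= -zv.
pose f q := (map_poly (in_alg L) q).[t].
pose N : {poly kperf} := c%:P + d%:P * 'X; pose D : {poly kperf} := a%:P + b%:P * 'X.
have fE u v : f (u%:P + v%:P * 'X) = u%:A + v *: t.
  by rewrite /f rmorphD rmorphM /= map_polyX !map_polyC !hornerE mulr_algl.
have : f (quartic W%:P N D) = 0.
  rewrite /f (rmorph_quartic (map_poly (in_alg L))) -[LHS]/(horner_eval t _).
  rewrite (rmorph_quartic (horner_eval t)) /=.
  rewrite map_polyC /= /horner_eval hornerC -/(f N) -/(f D) !fE -zN.
  have -> v : quartic W%:A (z * v) v = quartic W%:A z 1 * v ^+ 4 by rewrite /quartic; ring.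
  by rewrite qz mul0r.
move/minpoly_t; set Q := quartic _ _ _.
pose E := c * b + a * d; have QE := quartic_linear kperf_pchar W a b c d.
rewrite -/Q -/E in QE.
move=> PQ; have {PQ} Qc i : Q`_i = Q`_4 * (quart_poly uperf)`_i.
  apply/eqP; rewrite -subr_eq0 -coefCM -coefB; apply/eqP.
  suff -> : Q - (Q`_4)%:P * quart_poly uperf = 0 by rewrite coef0.
  apply/eqP/contraT => nz.
  have : quart_poly uperf %| Q - (Q`_4)%:P * quart_poly uperf.
    by rewrite dvdp_sub // dvdp_mull.
  move=> /(dvdp_leq nz); rewrite size_quart_poly ltnNge => /negP[].
  apply/leq_sizeP => j; rewrite leq_eqVlt => /orP[/eqP <-|lt4j].
    by rewrite coefB coefCM coef_quart_poly /= mulr1 subrr.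
  rewrite coefB coefCM coef_quart_poly [X in _ * X]nth_default // mulr0 subr0.
  by rewrite QE coef_Poly nth_default.
have := Qc 3; have := Qc 2; have := Qc 1; have := Qc 4.
rewrite !coef_quart_poly !QE !coef_Poly /= => _.
rewrite !mulr0 !mulr1 => eq1 eq2 /eqP.
have W0 : W != 0 by rewrite expf_neq0 // uroot_neq0.
have zD v : v%:A * (a%:A + b *: t) <> c%:A + d *: t.
  by rewrite -zN => /(mulIf D0)/esym; apply: znF.
have [b0|b0] := eqVneq b 0; last first.
  rewrite 2!mulf_eq0 (negPf W0) (expf_eq0 b) (negPf b0) /= orbF => /eqP E0.
  case: (zD (d / b)); rewrite mulrDr !mulr_algl !scalerA divfK //.
  congr (_ *: _ + _).
  apply: (mulIf b0); rewrite mulrAC divfK //; apply/eqP.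
  by rewrite -subr_eq0 (oppr_pchar2 kperf_pchar) [d * a]mulrC addrC -/E E0.
have a0 : a != 0 by apply: contraNneq D0 => ->; rewrite b0 !scale0r addr0.
have [d0|d0 _] := eqVneq d 0.
  case: (zD (c / a)); rewrite b0 d0 !scale0r !addr0 -(rmorphM (in_alg L)) /=.
  by rewrite divfK.
have qd : quartic W d b = d ^+ 4 by rewrite b0 /quartic; ring.
have da : d = a.
  apply: (pow_inj kperf_pchar (e := 1)); apply: (mulIf (expf_neq0 2 d0)).
  by rewrite /= expn1 -exprD -qd -eq2 b0 !(mulr0, expr0n, add0r, addr0).
case: neq_e; apply: uroot_pow_inj; rewrite -/W.
apply: (mulIf (expf_neq0 4 a0)); rewrite [RHS]mulrC -{2}da -qd -eq1 /E b0 da; ring.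
Qed.

End Roots.

(** * Evaluation of forms at (t, 1) *)

Definition bimon (i j : nat) : 'X_{1..2} := [multinom (if k == ord0 then i else j) | k < 2].

Lemma mdeg2 (m : 'X_{1..2}) : mdeg m = (m ord0 + m ord_max)%N.
Proof. by rewrite mdegE !big_ord_recl big_ord0 addn0; congr (_ + m _)%N; apply: val_inj. Qed.

Lemma bimon0 i j : bimon i j ord0 = i. Proof. by rewrite mnmE. Qed.
Lemma bimon1 i j : bimon i j ord_max = j. Proof. by rewrite mnmE. Qed.

Lemma mdeg_bimon i j : mdeg (bimon i j) = (i + j)%N.
Proof. by rewrite mdeg2 bimon0 bimon1. Qed.

Lemma bimonE (m : 'X_{1..2}) : m = bimon (m ord0) (mdeg m - m ord0).
Proof.
apply/mnmP => k; rewrite mnmE mdeg2 addKn; case: eqP => [->//|k0].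
congr (m _); apply: val_inj; case: k k0 => [[|[|//]] lt] //= k0.
by case: k0; apply: val_inj.
Qed.

Section Forms.
Variables (F : fieldType) (S : comNzRingType) (phi : {rmorphism F -> S}) (tau : S).
Implicit Types (q : {mpoly F[2]}) (g h : mfps 2 F).

(** The value at (tau, 1) of the homogeneous component of degree n, that is the
    coefficient of Y^n in the image of g under x |-> tau Y, y |-> Y. *)
Definition form_at (n : nat) g : S :=
  \sum_(i < n.+1) phi (fcoef g (bimon i (n - i))) * tau ^+ i.

Lemma form_atB n : zmod_morphism (form_at n).
Proof.
move=> g h; rewrite /form_at -sumrB; apply: eq_bigr => i _.
by rewrite -mulrBl -rmorphB.
Qed.
HB.instance Definition _ n :=
  GRing.isZmodMorphism.Build (mfps 2 F) S (form_at n) (form_atB n).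

Lemma form_at_ext n g h :
  (forall m, mdeg m = n -> fcoef g m = fcoef h m) -> form_at n g = form_at n h.
Proof.
move=> gh; apply: eq_bigr => i _; rewrite gh //.
by rewrite mdeg_bimon subnKC // -ltnS.
Qed.

Let ev q : {poly S} :=
  mmap (polyC \o phi) (fun i => if i == ord0 then tau%:P * 'X else 'X) q.

Lemma ev_form n q : (ev q)`_n = form_at n (fps_of_mpoly q).
Proof.
have evX c m : (ev (c *: 'X_[m]))`_n = form_at n (fps_of_mpoly (c *: 'X_[m])).
  rewrite /ev mmapZ mmapX /mmap1 !big_ord_recl big_ord0 mulr1 /=.
  rewrite exprMn -!mulrA -exprD -rmorphXn /= mulrA -rmorphM coefCM coefXn.
  have -> : (m ord0 + m (lift ord0 ord0) = mdeg m)%N.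
    by rewrite mdeg2; congr (_ + m _)%N; apply: val_inj.
  rewrite /form_at /=; under eq_bigr do rewrite mcoeffZ mcoeffX.
  have [eq_n|neq_n] := eqVneq n (mdeg m); last first.
    rewrite mulr0 big1 // => i _; case: eqP => [mE|_]; last by rewrite mulr0 rmorph0 mul0r.
    case/eqP: neq_n; rewrite mE mdeg_bimon subnKC // -ltnS; exact: ltn_ord.
  have lt_m : (m ord0 < n.+1)%N by rewrite eq_n mdeg2 ltnS leq_addr.
  rewrite (bigD1 (Ordinal lt_m)) //= {1}eq_n -bimonE eqxx !mulr1 big1 ?addr0 //.
  move=> i neq_i; case: eqP => [mE|_]; last by rewrite mulr0 rmorph0 mul0r.
  by case/eqP: neq_i; apply: val_inj; rewrite /= mE bimon0.
rewrite [q]mpolyE raddf_sum /= [ev _]raddf_sum coef_sum.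
by rewrite [RHS]raddf_sum; apply: eq_bigr.
Qed.

Lemma ev_trunc d n g : (n < d)%N -> (ev (fps_trunc d g))`_n = form_at n g.
Proof.
move=> lt_nd; rewrite ev_form; apply: form_at_ext => m mn.
by rewrite /= fps_truncE // mn.
Qed.

Lemma form_atM n g h :
  form_at n (g * h) = \sum_(i < n.+1) form_at i g * form_at (n - i) h.
Proof.
transitivity (ev (fps_trunc n.+1 g * fps_trunc n.+1 h))`_n.
  rewrite ev_form; apply: form_at_ext => m mn /=.
  by apply: fps_mul_truncl; rewrite mn.
rewrite /ev rmorphM coefM; apply: eq_bigr => i _.
by rewrite -!/(ev _) !ev_trunc // ltnS leq_subr.
Qed.

Lemma form_at_mpolyC n c : form_at n (fps_of_mpoly c%:MP) = (if n == 0 then phi c else 0).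
Proof. by rewrite -ev_form /ev mmapC coefC. Qed.

Lemma form_at_X n i : form_at n (fps_of_mpoly 'X_i) =
  (if n == 1 then (if i == ord0 then tau else 1) else 0).
Proof.
rewrite -ev_form /ev mmapX mmap1U; case: ifP => _; rewrite ?coefCM coefX.
all: by case: eqP; rewrite ?mulr1 ?mulr0.
Qed.

Lemma form_at_quartic n c :
  form_at n (quart_fps c) = (if n == 4 then quartic (phi c) tau 1 else 0).
Proof.
rewrite quart_fpsE -ev_form /quart_mpoly /ev (rmorph_quartic (mmap _ _)) /=.
rewrite mmapC !mmapX !mmap1U /=.
have -> : quartic (phi c)%:P (tau%:P * 'X) 'X = (quartic (phi c) tau 1)%:P * 'X^4.
  rewrite (rmorph_quartic polyC) /quartic rmorph1; ring.
by rewrite coefCM coefXn; case: eqP; rewrite ?mulr1 ?mulr0.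
Qed.

End Forms.

(** * The ideal of the quartic as a kernel *)

Section QuarticKernel.
Variables (F : fieldType) (c : F) (L : fieldExtType F) (t : L).
Hypothesis minpoly_t : forall q : {poly F},
  (map_poly (in_alg L) q).[t] = 0 <-> quart_poly c %| q.
Implicit Types (q : {mpoly F[2]}) (g h : mfps 2 F).

Let form n g : L := form_at (in_alg L) t n g.
(* The component of degree n, dehomogenized at y = 1. *)
Let form_poly n g : {poly F} := form_at polyC 'X n g.

Lemma form_polyE n g : form_poly n g = \poly_(i < n.+1) fcoef g (bimon i (n - i)).
Proof. by rewrite poly_def; apply: eq_bigr => i _; rewrite mul_polyC. Qed.

Lemma form_polyP g h : (forall n, form_poly n g = form_poly n h) -> g = h.
Proof.
have coefE f (m : 'X_{1..2}) : fcoef f m = (form_poly (mdeg m) f)`_(m ord0).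
  by rewrite form_polyE coef_poly ltnS mdeg2 leq_addr -mdeg2 -bimonE.
by move=> gh; apply: fpsP => m; rewrite !coefE gh.
Qed.

Lemma form_horner n g : form n g = (map_poly (in_alg L) (form_poly n g)).[t].
Proof.
rewrite /form_poly /form_at rmorph_sum horner_sum; apply: eq_bigr => i _.
by rewrite rmorphM rmorphXn /= map_polyC map_polyX !hornerE.
Qed.

Lemma size_form_poly n g : (size (form_poly n g) <= n.+1)%N.
Proof. by rewrite form_polyE size_poly. Qed.

Let P := quart_poly c.
Let sP : size P = 5 := size_quart_poly c.
Let P0 : P != 0. Proof. by rewrite -size_poly_eq0 sP. Qed.

Lemma form_poly_quartM n h :
  form_poly n (quart_fps c * h) = if (n < 4)%N then 0 else P * form_poly (n - 4) h.
Proof.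
have formf i : form_poly i (quart_fps c) = if i == 4 then P else 0.
  exact: form_at_quartic.
rewrite /form_poly form_atM; case: ltnP => [lt_n4|le_4n].
  rewrite big1 // => i _; rewrite -/(form_poly _ _) formf ltn_eqF ?mul0r //.
  by rewrite (leq_trans (ltn_ord i)).
rewrite (bigD1 (Ordinal (le_4n : 4 < n.+1)%N)) //= big1 ?addr0 => [|i neq_i].
  by rewrite -/(form_poly _ _) formf.
rewrite -/(form_poly _ _) formf; case: eqP => [i4|]; last by rewrite mul0r.
by case/eqP: neq_i; apply: val_inj.
Qed.

(** If the form of degree n vanishes at (t, 1) for all n, the minimal polynomial
    divides every dehomogenized component; the quotients, homogenized in degree
    n - 4, are the components of the cofactor. *)
Lemma form_eq0 g : (forall n, form n g = 0) <-> in_quart_fps c g.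
Proof.
split=> [g0|/asboolP[h ->] n]; last first.
  rewrite form_horner mulrC form_poly_quartM; case: ifP => _.
    by rewrite rmorph0 horner0.
  by apply/minpoly_t; rewrite dvdp_mulr.
have gP n : P %| form_poly n g by apply/minpoly_t; rewrite -form_horner.
pose h : mfps 2 F := MFps (fun m : 'X_{1..2} => (form_poly (mdeg m + 4) g %/ P)`_(m ord0)).
have hE n : form_poly n h = form_poly (n + 4) g %/ P.
  rewrite form_polyE; apply/polyP => i; rewrite coef_poly /= bimon0 mdeg_bimon.
  case: ltnP => [|le_ni]; first by rewrite ltnS => /subnKC ->.
  rewrite nth_default // (leq_trans _ le_ni) //.
  by rewrite size_divp // sP leq_subLR (leq_trans (size_form_poly _ _)) // -addnS addnC.
apply/asboolP; exists h; rewrite mulrC; apply: form_polyP => n.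
rewrite form_poly_quartM; case: ltnP => [lt_n4|le_4n].
  apply/eqP/contraT => nz; have := leq_trans (dvdp_leq nz (gP n)) (size_form_poly n g).
  by rewrite sP ltnS leqNgt lt_n4.
by rewrite hE subnK // mulrC divpK.
Qed.

(** The cofactor found among the power series is a polynomial, since its components
    vanish in large degree together with those of q. *)
Lemma form_mpoly_eq0 q :
  (forall n, form n (fps_of_mpoly q) = 0) <-> in_quart_mpoly c q.
Proof.
split=> [/form_eq0/asboolP[h qE]|/asboolP[h ->]]; last first.
  by apply/form_eq0/asboolP; exists (fps_of_mpoly h); rewrite rmorphM quart_fpsE.
have h0 n : (msize q <= n)%N -> form_poly n h = 0.
  move=> le_n; have : form_poly (n + 4) (fps_of_mpoly q) = 0.
    rewrite form_polyE; apply/polyP => i; rewrite coef_poly coef0 /=.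
    case: ifP => // lt_i; apply: memN_msupp_eq0; apply: msize_mdeg_ge.
    by rewrite mdeg_bimon; lia.
  rewrite qE mulrC form_poly_quartM ltnNge leq_addl /= addnK => /eqP.
  by rewrite mulf_eq0 (negPf P0) => /eqP.
have hE : h = fps_of_mpoly (fps_trunc (msize q) h).
  apply: fpsP => m /=; have [lt_m|le_m] := ltnP (mdeg m) (msize q).
    by rewrite fps_truncE.
  have := congr1 (fun p : {poly F} => p`_(m ord0)) (h0 _ le_m).
  rewrite form_polyE coef_poly ltnS mdeg2 leq_addr -mdeg2 -bimonE coef0 => ->.
  rewrite raddf_sum /= big1 // => m' _; rewrite mcoeffZ mcoeffX.
  case: eqP => [mE|_]; last by rewrite mulr0.
  by have := bmdeg m'; rewrite mE ltnNge le_m.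
apply/asboolP; exists (fps_trunc (msize q) h).
rewrite hE quart_fpsE -rmorphM in qE.
by apply/mpolyP => m; have := congr1 (fun f => fcoef f m) qE.
Qed.
End QuarticKernel.

(** * The two rings *)

(** T is the polynomial ring or the power series ring, and psi its embedding into
    the power series. *)
Section QuotientExpansion.
Variables (F : fieldType) (L : fieldExtType F) (t : L).
Variables (T : comNzRingType) (psi : {rmorphism T -> mfps 2 F}) (I : idealr T).
Variables (cstT : {rmorphism F -> T}) (xT yT : T).
Hypothesis psi_cst : forall a, psi (cstT a) = fps_of_mpoly a%:MP.
Hypothesis psi_x : psi xT = fps_of_mpoly 'X_ord0.
Hypothesis psi_y : psi yT = fps_of_mpoly 'X_ord_max.

Let form n g : L := form_at (in_alg L) t n g.
Hypothesis form_ker : forall g, (forall n, form n (psi g) = 0) <-> g \in I.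

Definition quot_co n (a : {ideal_quot I}) : L := form_at (in_alg L) t n (psi (repr a)).
Definition quot_cst : {rmorphism F -> {ideal_quot I}} := \pi_({ideal_quot I}) \o cstT.

Lemma quot_coE n g : quot_co n (\pi_({ideal_quot I}) g) = form n (psi g).
Proof.
apply/eqP; rewrite /quot_co -subr_eq0 -!raddfB /=; apply/eqP.
by apply: (form_ker _).2; rewrite Quotient.idealrBE reprK.
Qed.

Lemma quotient_expansion :
  expansion t quot_cst (\pi_({ideal_quot I}) xT) (\pi_({ideal_quot I}) yT) quot_co.
Proof.
split=> [n|n|n a|n|n|||].
- elim/quotW=> g; elim/quotW=> h.
  by rewrite -[\pi g - \pi h](raddfB \pi_({ideal_quot I})) !quot_coE rmorphB /form raddfB.
- elim/quotW=> g; elim/quotW=> h.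
  rewrite -[\pi g * \pi h](rmorphM \pi_({ideal_quot I})) quot_coE rmorphM /form form_atM.
  by apply: eq_bigr => i _; rewrite !quot_coE.
- by rewrite quot_coE psi_cst /form form_at_mpolyC.
- by rewrite quot_coE psi_x /form form_at_X.
- by rewrite quot_coE psi_y /form form_at_X.
- move=> r; exists (fcoef (psi (repr r)) (bimon 0 0)).
  by rewrite /quot_co /form_at big_ord_recl big_ord0 addr0 mulr1.
- move=> r; exists (fcoef (psi (repr r)) (bimon 0 1)), (fcoef (psi (repr r)) (bimon 1 0)).
  by rewrite /quot_co /form_at !big_ord_recl big_ord0 addr0 mulr1 /= mulr_algl.
elim/quotW=> g g0.
have Ig : g \in I by apply/form_ker => n; rewrite -quot_coE.
by apply/eqP; rewrite -(rmorph0 \pi_({ideal_quot I})) -Quotient.idealrBE subr0.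
Qed.

End QuotientExpansion.

Section QuarticExpansions.
Variables (F : fieldType) (c : F) (L : fieldExtType F) (t : L).
Hypothesis span_t : forall z : L, exists a : 'I_4 -> F, z = \sum_i a i *: t ^+ i.
Hypothesis minpoly_t : forall q : {poly F},
  (map_poly (in_alg L) q).[t] = 0 <-> quart_poly c %| q.

Local Notation piA := (\pi_({ideal_quot (ideal_mpoly c)})).
Local Notation piH := (\pi_({ideal_quot (ideal_fps c)})).
Let coA := quot_co t (@fps_of_mpoly 2 F) (I := ideal_mpoly c).
Let coH := quot_co t idfun (I := ideal_fps c).

Definition quot_mpoly_cst : {rmorphism F -> quot_mpoly c} :=
  quot_cst (ideal_mpoly c) (@mpolyC 2 F).
Definition quot_fps_cst : {rmorphism F -> quot_fps c} :=
  quot_cst (ideal_fps c) (@fps_of_mpoly 2 F \o @mpolyC 2 F).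

Lemma quot_mpoly_expansion : expansion t quot_mpoly_cst
  (piA 'X_ord0)
  (piA 'X_ord_max) coA.
Proof. by apply: quotient_expansion => // q; apply: form_mpoly_eq0. Qed.

Lemma quot_fps_expansion : expansion t quot_fps_cst
  (piH (fpsX F ord0))
  (piH (fpsX F ord_max)) coH.
Proof. by apply: quotient_expansion => // q; apply: form_eq0. Qed.

Lemma quot_mpoly_coE n q : coA n (piA q) =
  form_at (in_alg L) t n (fps_of_mpoly q).
Proof. by apply: quot_coE => q'; apply: form_mpoly_eq0. Qed.

Lemma quot_fps_coE n g : coH n (piH g) =
  form_at (in_alg L) t n g.
Proof. by apply: quot_coE => g'; apply: form_eq0. Qed.

Lemma quot_mpoly_finite r : exists d, forall n, (d <= n)%N -> coA n r = 0.
Proof.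
elim/quotW: r => q; exists (msize q) => n le_n.
rewrite quot_mpoly_coE /form_at big1 // => i _ /=.
rewrite memN_msupp_eq0 ?scale0r ?mul0r //; apply: msize_mdeg_ge.
by rewrite mdeg_bimon subnKC // -ltnS.
Qed.

(** In degree n >= 3 a coefficient in L is spread over the monomials x^i y^(n - i)
    with i < 4. *)
Lemma quot_fps_full (s : nat -> L) : (forall i, (i < 3)%N -> s i = 0) ->
  exists r, forall n, coH n r = s n.
Proof.
move=> s0; have /choice[a aE] : forall n, exists a : 'I_4 -> F, s n = \sum_i a i *: t ^+ i.
  by move=> n; apply: span_t.
pose b n i := if (3 <= n)%N then (if insub i is Some k then a n k else 0) else 0.
pose g : mfps 2 F := MFps (fun m : 'X_{1..2} => b (mdeg m) (m ord0)).
exists (piH g) => n; rewrite quot_fps_coE.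
have -> : form_at (in_alg L) t n g = \sum_(i < n.+1) b n i *: t ^+ i.
  apply: eq_bigr => i _; rewrite /= bimon0 mdeg_bimon subnKC ?mulr_algl //.
  by rewrite -ltnS.
rewrite /b; have [le3n|lt_n3] := leqP 3 n; last first.
  by rewrite (s0 _ lt_n3) big1 // => i _; rewrite scale0r.
rewrite (bigID (fun i : 'I__ => i < 4)%N) /= [X in _ + X]big1 ?addr0; last first.
  by move=> i le4i; rewrite insubN // scale0r.
have le4n : (4 <= n.+1)%N by [].
by rewrite (big_ord_narrow le4n) aE; apply: eq_bigr => i _; rewrite valK.
Qed.

Lemma quot_grading_graded : graded_ring (@quot_grading F c).
Proof.
have coE := quot_mpoly_expansion.
have GP n r : reflect (exists2 q : {mpoly F[2]}, q \is n.-homog & r = piA q)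
    (r \in @quot_grading F c n) by apply: asboolP.
have G_co a n r : r \in @quot_grading F c a -> n != a -> coA n r = 0.
  move=> /GP[q hq ->] neq_na; rewrite quot_mpoly_coE /form_at big1 // => i _ /=.
  have /(dhomog_nemf_coeff hq) -> : mdeg (bimon i (n - i)) != a.
    by rewrite mdeg_bimon subnKC // -ltnS.
  by rewrite scale0r mul0r.
split; first split.
- move=> n; split=> [|u v /GP[q hq ->] /GP[q' hq' ->]]; apply/GP.
    by exists 0; rewrite ?rpred0 // rmorph0.
  by exists (q - q'); rewrite ?rpredB // rmorphB.
- elim/quotW=> q; exists (iota 0 (msize q)), (fun n => piA (pihomog mdeg n q)).
  split; first exact: iota_uniq.
    by move=> n; apply/GP; exists (pihomog mdeg n q); rewrite ?pihomogP.
  rewrite {1}(pihomog_partitionE (leqnn (msize q))) rmorph_sum /=.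
  by rewrite -(big_mkord xpredT (fun n => piA (pihomog mdeg n q))) /index_iota subn0.
- move=> s u uniq_s Gu su0 a sa; apply: (co_inj coE) => n.
  have [->|] := eqVneq n a; last exact: G_co.
  pose coAB := GRing.isZmodMorphism.Build _ _ (coA a) (coB coE a).
  pose coA' : {additive _ -> _} := HB.pack (coA a) coAB.
  have := congr1 coA' su0; rewrite (big_rem a sa) raddfD raddf_sum raddf0 /=.
  rewrite big1_seq ?addr0 // => i /andP[_]; rewrite mem_rem_uniq // inE => /andP[ia _].
  by rewrite (G_co i) // eq_sym.
- by apply/GP; exists 1; rewrite ?dhomog1 ?rmorph1.
move=> a b u v /GP[q hq ->] /GP[q' hq' ->]; apply/GP.
by exists (q * q'); rewrite ?dhomogM ?rmorphM.
Qed.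

End QuarticExpansions.

Lemma finite_graded_F_rep (R : comNzRingType) (p : nat) (charRp : p \in [pchar R]) G :
  finite_graded_F_rep_type charRp G -> finite_F_rep_type charRp.
Proof.
move=> [s [M [H [fgM decM]]]]; exists s, M; split=> [i|e]; first by case: (fgM i).
by have [n [a [f [bij_f _]]]] := decM e; exists n, f.
Qed.

Theorem mainTheorem3 :
  [/\ is_domain ringA, graded_ring gradA, noetherian ringA, krull_dim_eq ringA 1
    & ~ finite_graded_F_rep_type ringA_pchar gradA] /\
  [/\ is_domain ringAhat, complete_local ringAhat, krull_dim_eq ringAhat 1
    & ~ finite_F_rep_type ringAhat_pchar].
Proof.
have noroot (z : kperf) : quartic uperf z 1 != 0.
  by rewrite -(urootK 0); apply: kperf_quartic_neq0.
have [L [t [span_t minpoly_t]]] :=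
  quartic_extension kperf_pchar noroot kperf_cubic_neq.
have /choice[root_t root_tK] := L_root span_t minpoly_t.
have moeb e e' (a b c d : kperf) : e <> e' ->
    root_t e ^+ (2 ^ e') * (a%:A + b *: t) = c%:A + d *: t -> a%:A + b *: t = 0.
  exact: (not_moebius minpoly_t (root_tK e)).
have expA := quot_mpoly_expansion minpoly_t.
have expH := quot_fps_expansion minpoly_t.
have codimA := finite_expansion_codim expA span_t (quot_mpoly_finite minpoly_t).
have fullH := quot_fps_full span_t minpoly_t.
have codimH := full_expansion_codim expH span_t fullH.
split; split.
- exact: expansion_domain expA.
- exact: quot_grading_graded minpoly_t.
- exact: finite_codim_noetherian codimA.
- exact: expansion_dim1 expA codimA.
- by move=> /finite_graded_F_rep; apply: (expansion_not_FFRT expA span_t root_tK moeb).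
- exact: expansion_domain expH.
- exact: full_complete_local expH span_t fullH.
- exact: expansion_dim1 expH codimH.
exact: (expansion_not_FFRT expH span_t root_tK moeb).
Qed.
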